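(* There exist exactly $6$ unimodular equivalence classes of $5$-dimensional Gorenstein simplices in $\mathbb{R}^5$ of degree $3$ which are not lattice pyramids.
   Context: A lattice polytope is a convex polytope in $\mathbb{R}^d$ all of whose vertices lie in $\mathbb{Z}^d$. Two lattice polytopes $P,Q\subset\mathbb{R}^d$ are unimodularly equivalent if $Q=f_U(P)+\mathbf{w}$ for some $\mathbf{w}\in\mathbb{Z}^d$ and some $U\in\mathbb{Z}^{d\times d}$ with $\det U=\pm1$, where $f_U(\mathbf{x})=\mathbf{x}U$. For a lattice polytope $P\subset\mathbb{R}^{d}$ of dimension $d$, $\mathrm{Pyr}(P)=\mathrm{conv}(P\times\{0\},(0,\dots,0,1))\subset\mathbb{R}^{d+1}$; a lattice polytope is a lattice pyramid if, up to unimodular equivalence, it is obtained by successively applying $\mathrm{Pyr}$ (at least once) to a lower-dimensional lattice polytope. For a $d$-dimensional lattice polytope $P\subset\mathbb{R}^d$, $\mathrm{codeg}(P)=\min\{n\in\mathbb{Z}_{>0}:\mathrm{int}(nP)\cap\mathbb{Z}^d\ne\emptyset\}$ and the degree is $\deg(P)=d+1-\mathrm{codeg}(P)$. A $d$-dimensional lattice polytope $P\subset\mathbb{R}^d$ is reflexive if the origin is in its interior and $P^\vee=\{\mathbf{y}\in\mathbb{R}^d:\langle\mathbf{x},\mathbf{y}\rangle\le1\ \forall\mathbf{x}\in P\}$ is a lattice polytope; $P$ is Gorenstein if $rP$ is unimodularly equivalent to a reflexive polytope for some integer $r\ge1$. A Gorenstein simplex is a lattice simplex that is Gorenstein. *)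

(* Defs.v *)
From mathcomp Require Export all_boot all_order all_algebra.
From mathcomp Require Export all_classical all_reals all_analysis.

Set Implicit Arguments.
Unset Strict Implicit.
Unset Printing Implicit Defensive.

Import Order.TTheory GRing.Theory Num.Theory.
Import numFieldNormedType.Exports.

Local Open Scope classical_set_scope.
Local Open Scope ring_scope.

Section LatticePolytopes.
Variable R : realType.

Definition lattice (d : nat) : set 'rV[R]_d :=
  range (fun z : 'rV[int]_d => map_mx intr z).
Arguments lattice : clear implicits.

Definition conv (d : nat) (A : set 'rV[R]_d) : set 'rV[R]_d :=
  smallest (@convex_set R 'rV[R]_d) A.

Definition polytope (d : nat) (P : set 'rV[R]_d) : Prop :=
  exists2 A : set 'rV[R]_d, finite_set A & P = conv A.

(* The vertices of a polytope, as its extreme points. *)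
Definition vertices (d : nat) (P : set 'rV[R]_d) : set 'rV[R]_d :=
  [set x | P x /\ forall (y z : 'rV[R]_d) (t : R), P y -> P z ->
     0 < t < 1 -> x = t *: y + (1 - t) *: z -> y = x /\ z = x].

Definition lattice_polytope (d : nat) (P : set 'rV[R]_d) : Prop :=
  polytope P /\ vertices P `<=` lattice d.

Definition aff_indep (d k : nat) (v : 'I_k.+1 -> 'rV[R]_d) : Prop :=
  row_free (\matrix_(i < k) (v (lift ord0 i) - v ord0)).

(* [P] has dimension [k], the dimension of its affine hull: [k.+1] is the
   maximal number of affinely independent points of [P]. *)
Definition has_dim (d : nat) (P : set 'rV[R]_d) (k : nat) : Prop :=
  (exists2 v : 'I_k.+1 -> 'rV[R]_d, range v `<=` P & aff_indep v) /\
  (forall v : 'I_k.+2 -> 'rV[R]_d, range v `<=` P -> ~ aff_indep v).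

Definition simplex (d : nat) (P : set 'rV[R]_d) : Prop :=
  exists k, exists2 v : 'I_k.+1 -> 'rV[R]_d, aff_indep v & P = conv (range v).

Definition unimod_equiv (d : nat) (P Q : set 'rV[R]_d) : Prop :=
  exists (U : 'M[int]_d) (w : 'rV[int]_d), (\det U = 1 \/ \det U = -1) /\
    Q = [set x *m map_mx intr U + map_mx intr w | x in P].

Definition unimod_class (d : nat) (P : set 'rV[R]_d) : set (set 'rV[R]_d) :=
  [set Q | unimod_equiv P Q].

(* [x] in R^d as the point [(x, 0)] of R^(d+1). *)
Definition embed0 (d : nat) (x : 'rV[R]_d) : 'rV[R]_d.+1 :=
  \row_(j < d.+1) if unlift ord_max j is Some i then x 0 i else 0.

Definition Pyr (d : nat) (P : set 'rV[R]_d) : set 'rV[R]_d.+1 :=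
  conv ([set embed0 x | x in P] `|` [set delta_mx 0 ord_max]).

Inductive iterated_Pyr : forall d : nat, set 'rV[R]_d -> Prop :=
| Pyr_once d (Q : set 'rV[R]_d) :
    lattice_polytope Q -> has_dim Q d -> iterated_Pyr (Pyr Q)
| Pyr_again d (Q : set 'rV[R]_d) :
    iterated_Pyr Q -> iterated_Pyr (Pyr Q).

Definition lattice_pyramid (d : nat) (P : set 'rV[R]_d) : Prop :=
  exists2 Q : set 'rV[R]_d, iterated_Pyr Q & unimod_equiv P Q.

Definition dilate (d : nat) (n : nat) (P : set 'rV[R]_d) : set 'rV[R]_d :=
  [set n%:R *: x | x in P].

(* The set of which the minimum is taken is nonempty for every
   [d]-dimensional lattice polytope, so that the default 0 plays no role. *)
Definition codegree (d : nat) (P : set 'rV[R]_d) : nat :=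
  let S := [set n : nat | (0 < n)%N /\
                          interior (dilate n P) `&` lattice d !=set0] in
  xget 0%N [set n | S n /\ forall m, S m -> (n <= m)%N].

(* The codegree of a [d]-dimensional lattice polytope is at most [d + 1], so
   that the subtraction is not truncated. *)
Definition degree (d : nat) (P : set 'rV[R]_d) : nat := (d.+1 - codegree P)%N.

Definition polar_dual (d : nat) (P : set 'rV[R]_d) : set 'rV[R]_d :=
  [set y | forall x, P x -> \sum_(i < d) x 0 i * y 0 i <= 1].

Definition reflexive_polytope (d : nat) (P : set 'rV[R]_d) : Prop :=
  [/\ lattice_polytope P, has_dim P d, interior P 0 &
      lattice_polytope (polar_dual P)].

Definition gorenstein (d : nat) (P : set 'rV[R]_d) : Prop :=
  [/\ lattice_polytope P, has_dim P d &
      exists (r : nat) (Q : set 'rV[R]_d),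
        [/\ (1 <= r)%N, reflexive_polytope Q & unimod_equiv (dilate r P) Q]].

End LatticePolytopes.

Arguments lattice : clear implicits.

(* Main.v *)
From mathcomp Require Import perm.
Require Import Defs.
Import Order.TTheory GRing.Theory Num.Theory.
Import numFieldNormedType.Exports.
Local Open Scope classical_set_scope.
Local Open Scope ring_scope.

Set Implicit Arguments.
Unset Strict Implicit.
Unset Printing Implicit Defensive.

(** Let [P] be the simplex whose vertices are the rows of an integer matrix
[V], and let [homog V] be [V] preceded by a column of ones, so that barycentric
coordinates are read off by inverting [homog V].

_Reduction to a parity condition._  The primitive inner facet functionals of
[P] are the columns of an integer matrix [N] with [homog V *m N = diag_mx m],
where [m i] is the lattice height of vertex [i] over the opposite facet.  The
polar dual of a simplex around the origin is again a simplex, and its being a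
lattice simplex means that every facet is at lattice distance one from the
origin.  Hence [P] is Gorenstein of index [r] exactly when some lattice point
[z] of [rP] takes the value one on every facet functional ([normals_gorenstein],
[gorenstein_normalsP]).  The barycentric coordinates of [z] are then the
[1 / m i], so they add up to [r]; moreover interior lattice points of [nP] have
barycentric coordinates at least [1 / m i], so the codegree is [r]
([normals_codegree]).  Finally [P] is a lattice pyramid exactly when some
[m i] is one ([lattice_pyramid_weight1]).  In dimension five, degree three means
[r = 3]; six numbers [1 / m i], each at most one half, add up to three only if
every [m i] is two ([normals_weights2]).  This is the notion [half_simplex].

_Classification._  When all weights are two, the lattice is determined by the
binary code of the integer relations, modulo two, between the rows of
[homog V]: a code of length six, with only even words, containing the all-one
word.  The words of weight four are the complements of the words of weight two,
so the code is determined by its words of weight two, that is, by which pairs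
of vertices are congruent modulo two ([zero_sums_of_pairs]).  Two half simplices
whose vertices are congruent in the same pattern are therefore equivalent
([half_simplex_parity]).  As all six vertices add up to zero modulo two, two
disjoint congruent pairs force the remaining two vertices to be congruent.  The
partitions of six vertices with this property are those of type 6, 4+2,
3+1+1+1, 2+2+2, 2+1+1+1+1 and 1+1+1+1+1+1 ([pairing_relation_type]).  Each type
occurs ([parity_simplex_half]), and the types are told apart by the sum of the
cubes of the class sizes, an invariant of unimodular equivalence because an
equivalence permutes the vertices ([half_simplex_invariant]). *)

(** * Homogenised coordinates and convex hulls *)

(** Writing points with a leading coordinate one turns affine combinations
into linear ones: [l] is a vector of barycentric coordinates of [x] in terms of
the rows of [V] exactly when [l *m homog V = homog x], and affine independence
of the rows becomes [row_free (homog V)]. *)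
Definition homog (K : pzRingType) (m d : nat) (V : 'M[K]_(m, d)) : 'M[K]_(m, 1 + d) :=
  row_mx (const_mx 1) V.

Section Homogenization.
Variable K : pzRingType.

Lemma mul_homogE m n d (l : 'M[K]_(n, m)) (V : 'M[K]_(m, d)) (x : 'M[K]_(n, d)) :
  l *m homog V = homog x <-> (forall i, \sum_j l i j = 1) /\ l *m V = x.
Proof.
have sumE i : (l *m const_mx 1 : 'cV[K]_n) i 0 = \sum_j l i j.
  by rewrite !mxE; apply: eq_bigr => j _; rewrite !mxE mulr1.
rewrite /homog mul_mx_row; split => [/eq_row_mx[h ->]|[h ->]].
  by split => // i; rewrite -sumE h mxE.
by congr row_mx; apply/colP => i; rewrite sumE h mxE.
Qed.

Lemma homog_inj m d : injective (@homog K m d).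
Proof. by move=> V W /eq_row_mx[]. Qed.

Lemma row_homog m d (V : 'M[K]_(m, d)) i : row i (homog V) = homog (row i V).
Proof. by rewrite /homog row_row_mx; congr row_mx; apply/rowP => j; rewrite !mxE. Qed.

Lemma homog_affine m d e (V : 'M[K]_(m, d)) (U : 'M[K]_(d, e)) (w : 'rV[_]_e) :
  homog (V *m U + const_mx 1 *m w) = homog V *m block_mx 1%:M w 0 U.
Proof. by rewrite /homog mul_row_block mulmx0 addr0 mulmx1 addrC. Qed.

End Homogenization.

Lemma map_homog (K L : pzRingType) (f : {rmorphism K -> L}) m d (V : 'M[K]_(m, d)) :
  map_mx f (homog V) = homog (map_mx f V).
Proof. by rewrite /homog map_row_mx map_const_mx rmorph1. Qed.

Section Hull.
Variable R : realType.

Definition hull (m d : nat) (V : 'M[R]_(m, d)) : set 'rV[R]_d :=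
  [set x | exists2 l : 'rV[_]_m, forall i, 0 <= l 0 i & l *m homog V = homog x].

Lemma convex_setP d (C : set 'rV[R]_d) :
  convex_set (C : set (convex_lmodType _)) <->
  forall (x y : 'rV[R]_d) (t : R), C x -> C y -> 0 <= t <= 1 -> C (t *: x + (1 - t) *: y).
Proof.
split=> [cC x y t Cx Cy /andP[t0 t1]|cC x y t /set_mem Cx /set_mem Cy].
  by have := cC x y (Itv01 t0 t1) (mem_set Cx) (mem_set Cy) => /set_mem.
by apply/mem_set/cC => //; rewrite ge0 le1.
Qed.

Lemma convex_hull m d (V : 'M[R]_(m, d)) : convex_set (hull V : set (convex_lmodType _)).
Proof.
apply/convex_setP => x y t [l l0 lx] [k k0 ky] /andP[t0 t1].
exists (t *: l + (1 - t) *: k) => [i|].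
  by rewrite !mxE addr_ge0 ?mulr_ge0 ?subr_ge0.
rewrite mulmxDl -!scalemxAl lx ky /homog !scale_row_mx add_row_mx; congr row_mx.
by apply/matrixP => i j; rewrite !mxE !mulr1 subrKC.
Qed.

Lemma hull_row m d (V : 'M[R]_(m, d)) i : hull V (row i V).
Proof.
exists (delta_mx 0 i) => [j|]; first by rewrite mxE ler0n.
by rewrite -rowE row_homog.
Qed.

(** Split off the first vertex: the other ones, after normalising their
coefficients, are covered by the induction hypothesis unless all of these
coefficients vanish. *)
Lemma hull_sub m d (V : 'M[R]_(m, d)) (C : set 'rV[R]_d) :
  convex_set (C : set (convex_lmodType _)) -> (forall i, C (row i V)) -> hull V `<=` C.
Proof.
move=> /convex_setP cC; elim: m V => [|m IH] V CV x [l l0].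
  by move=> /mul_homogE[/(_ 0)]; rewrite big_ord0 => /eqP; rewrite eq_sym oner_eq0.
move=> /mul_homogE[/(_ 0)]; rewrite big_ord_recl => s1 lV.
set t := l 0 0 in s1.
pose l' : 'rV[R]_m := \row_j l 0 (lift 0 j).
pose V' := row' 0 V.
have xE : x = t *: row 0 V + l' *m V'.
  rewrite -lV; apply/rowP => j; rewrite !mxE big_ord_recl; congr (_ + _).
  by apply: eq_bigr => k _; rewrite !mxE.
have l'0 i : 0 <= l' 0 i by rewrite mxE.
have sl' : \sum_j l' 0 j = 1 - t.
  by rewrite -s1 addrC addKr; apply: eq_bigr => k _; rewrite mxE.
have t1 : 0 <= 1 - t by rewrite -sl' sumr_ge0.
have [tE|tN] := eqVneq (1 - t) 0.
  suff l'E : l' = 0.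
    have -> : x = row 0 V by rewrite xE l'E mul0mx addr0 -(subKr 1 t) tE subr0 scale1r.
    exact: CV.
  apply/rowP => j; rewrite [RHS]mxE; apply/eqP.
  by move/eqP: sl'; rewrite tE psumr_eq0 // => /allP/(_ j (mem_index_enum j)).
have -> : x = t *: row 0 V + (1 - t) *: (((1 - t)^-1 *: l') *m V').
  by rewrite -scalemxAl scalerA divff // scale1r.
apply: cC; [exact: CV | | by rewrite l0 -subr_ge0].
apply: (IH V'); first by move=> i; rewrite (_ : row i V' = row (lift 0 i) V) //; apply/rowP => j; rewrite !mxE.
exists ((1 - t)^-1 *: l'); first by move=> i; rewrite mxE mulr_ge0 ?invr_ge0.
apply/mul_homogE; split => // i; rewrite ord1.
by under eq_bigr do rewrite mxE; rewrite -mulr_sumr sl' mulVf.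
Qed.

Lemma conv_convex d (A : set 'rV[R]_d) : convex_set (conv A : set (convex_lmodType _)).
Proof.
apply/convex_setP => x y t Ax Ay t01 C CA.
by have [/convex_setP cC _] := CA; apply: cC t01; [exact: Ax C CA | exact: Ay C CA].
Qed.

Lemma conv_range m d (v : 'I_m -> 'rV[R]_d) : conv (range v) = hull (\matrix_i v i).
Proof.
apply/seteqP; split.
  apply: smallest_sub; first exact: convex_hull.
  by move=> _ [i _ <-]; rewrite -(rowK v); exact: hull_row.
apply: hull_sub; first exact: conv_convex.
by move=> i; rewrite rowK; apply: sub_gen_smallest; exists i.
Qed.

(** Were an extreme point [x] outside [A], then [conv A] without [x] would
still be convex and contain [A]. *)
Lemma vertices_conv d (A : set 'rV[R]_d) : vertices (conv A) `<=` A.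
Proof.
move=> x [Ax ext]; apply: contrapT => nAx.
suff sub : conv A `<=` conv A `\ x by have [_] := sub x Ax; apply.
apply: smallest_sub; last first.
  by move=> y Ay; split; [exact: sub_gen_smallest | move=> /= yx; apply: nAx; rewrite -yx].
apply/convex_setP => y z t [Ay /= ny] [Az /= nz] /andP[t0 t1].
have cA := conv_convex (A := A); move/convex_setP : (cA) => cA'.
split; first by apply: cA' => //; rewrite t0.
have [tE|tn0] := eqVneq t 0; first by rewrite tE scale0r add0r subr0 scale1r.
have [tE|tn1] := eqVneq t 1; first by rewrite tE scale1r subrr scale0r addr0.
move=> /= xE; apply: ny; have [] := ext y z t Ay Az _ (esym xE); last by [].
by rewrite !lt_neqAle eq_sym tn0 tn1 t0 t1.
Qed.

Lemma vertices_hull_sub m d (V : 'M[R]_(m, d)) x : vertices (hull V) x -> exists i, x = row i V.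
Proof.
have <- : conv (range (fun i => row i V)) = hull V.
  by rewrite conv_range; congr hull; apply/row_matrixP => i; rewrite rowK.
by move=> /vertices_conv[i _ <-]; exists i.
Qed.

(** If a vertex is a proper convex combination of two points, comparing
barycentric coordinates, which are unique and nonnegative, shows that both
points have all their weight on this vertex. *)
Lemma vertices_hull m d (V : 'M[R]_(m, d)) i : row_free (homog V) -> vertices (hull V) (row i V).
Proof.
move=> fV; split; first exact: hull_row.
have key (y : 'rV[R]_d) (l l' : 'rV[R]_m) (t : R) : (forall j, 0 <= l 0 j) -> (forall j, 0 <= l' 0 j) -> 0 < t < 1 ->
    t *: l + (1 - t) *: l' = delta_mx 0 i -> l *m homog V = homog y -> y = row i V.
  move=> l0 l'0 /andP[t0 t1] lE ly.
  have lj j : j != i -> l 0 j = 0.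
    move=> ji; have /eqP := congr1 (fun u : 'rV[_]_m => u 0 j) lE.
    rewrite !mxE eqxx (negbTE ji) /= paddr_eq0 ?mulr_ge0 ?subr_ge0 ?(ltW t0) ?(ltW t1) //.
    by rewrite mulf_eq0 gt_eqF //= => /andP[/eqP].
  move/mul_homogE: ly => [/(_ 0) s1 <-].
  rewrite rowE; congr (_ *m _); apply/rowP => j; rewrite !mxE eqxx /=.
  have [->|/lj//] := eqVneq j i.
  by move: s1; rewrite (bigD1 i) //= big1 ?addr0 // => k; exact: lj.
move=> y z t [l l0 ly] [k k0 kz] t01 E.
have lkE : t *: l + (1 - t) *: k = delta_mx 0 i.
  apply: (row_free_inj fV); rewrite /= mulmxDl -!scalemxAl ly kz -rowE row_homog E.
  rewrite /homog !scale_row_mx add_row_mx; congr row_mx.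
  by apply/matrixP => a b; rewrite !mxE !mulr1 subrKC.
split; first exact: key lkE ly.
apply: (key z k l (1 - t)) => //; last by rewrite subKr addrC.
by move/andP: t01 => [? ?]; rewrite subr_gt0 gtrBl; apply/andP.
Qed.

End Hull.

(** * Dimension and interior of a simplex *)

Section Dim.
Variable R : realType.

Lemma const_mx1_mul d (w : 'rV[R]_d) : (const_mx 1 : 'M[R]_1) *m w = w.
Proof. by apply/rowP => j; rewrite !mxE big_ord1 !mxE mul1r. Qed.

Lemma hull_affine m d e (V : 'M[R]_(m, d)) (U : 'M[R]_(d, e)) (w : 'rV[R]_e) :
  [set x *m U + w | x in hull V] = hull (V *m U + const_mx 1 *m w).
Proof.
apply/seteqP; split => [_ [x [l l0 lx] <-]|y [l l0]].
  by exists l => //; rewrite homog_affine mulmxA lx -{2}(const_mx1_mul w) homog_affine.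
move=> /mul_homogE[s1 <-]; exists (l *m V).
  by exists l => //; apply/mul_homogE.
rewrite mulmxDr mulmxA [in RHS]mulmxA; congr (_ + _).
rewrite -[LHS]const_mx1_mul; congr (_ *m _).
by apply/rowP => j; rewrite !mxE -[LHS](s1 0); apply: eq_bigr => k _; rewrite !mxE mulr1.
Qed.

Lemma dilate_hull m d n (V : 'M[R]_(m, d)) : dilate n (hull V) = hull (n%:R *: V).
Proof.
have -> : n%:R *: V = V *m n%:R%:M + const_mx 1 *m (0 : 'rV[R]_d) by rewrite mulmx0 addr0 mul_mx_scalar.
by rewrite -hull_affine; apply: eq_imagel => x _; rewrite addr0 mul_mx_scalar.
Qed.

(** A linear relation between the differences [v i - v 0] is the same as
a relation between the [v i] whose coefficients add up to zero. *)
Lemma aff_indepE d k (v : 'I_k.+1 -> 'rV[R]_d) :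
  aff_indep v <-> row_free (homog (\matrix_i v i)).
Proof.
set V := \matrix_i v i; rewrite /aff_indep; set D := \matrix_(i < k) _.
have lD (l : 'rV[R]_k.+1) : \sum_j l 0 j = 0 -> l *m V = (\row_j l 0 (lift ord0 j)) *m D.
  rewrite big_ord_recl => /eqP; rewrite addr_eq0 => /eqP s0.
  rewrite !mulmx_sum_row big_ord_recl s0 rowK scaleNr.
  rewrite scaler_suml -sumrN -big_split /=; apply: eq_bigr => j _.
  by rewrite mxE !rowK scalerBr addrC.
have homog0 (l : 'rV[R]_k.+1) : l *m homog V = 0 <-> \sum_j l 0 j = 0 /\ l *m V = 0.
  rewrite /homog mul_mx_row -[0 in X in X <-> _]row_mx0.
  have sE : (l *m const_mx 1 : 'M[R]_1) = (\sum_j l 0 j)%:M.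
    by rewrite [LHS]mx11_scalar mxE; congr _%:M; apply: eq_bigr => j _; rewrite !mxE mulr1.
  rewrite sE; split => [/eq_row_mx[/matrixP/(_ 0 0) + ->]|[-> ->]].
    by rewrite !mxE.
  by congr row_mx; apply/matrixP => i j; rewrite !ord1 !mxE.
split=> free; apply: inj_row_free => l.
  move=> /homog0[s0]; rewrite (lD _ s0) -(mul0mx _ D) => /(row_free_inj free)/rowP l0.
  have l0' j : l 0 (lift ord0 j) = 0 by have := l0 j; rewrite !mxE.
  apply/rowP => j; rewrite mxE; case: (unliftP ord0 j) => [i ->//|->].
  by move: s0; rewrite big_ord_recl big1 // addr0.
move=> lD0; pose l' : 'rV[R]_k.+1 :=
  \row_j (if unlift ord0 j is Some i then l 0 i else - \sum_i l 0 i).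
have s0 : \sum_j l' 0 j = 0.
  rewrite big_ord_recl; under eq_bigr do rewrite mxE liftK.
  by rewrite mxE unlift_none addNr.
have lE : \row_j l' 0 (lift ord0 j) = l by apply/rowP => j; rewrite !mxE liftK.
have /(row_free_inj free)/rowP l'0 : l' *m homog V = 0 *m homog V.
  by rewrite mul0mx; apply/homog0; split; rewrite ?lD ?lE.
by rewrite -lE; apply/rowP => j; rewrite mxE l'0 !mxE.
Qed.

Lemma homog_in_hull m n d (V : 'M[R]_(m, d)) (u : 'I_n -> 'rV[R]_d) :
  range u `<=` hull V -> exists L : 'M[R]_(n, m), homog (\matrix_i u i) = L *m homog V.
Proof.
move=> uV; have /choice[l lE] : forall i, exists l : 'rV[R]_m, l *m homog V = homog (u i).
  by move=> i; have [|l _ lE] := uV (u i); [exists i | exists l].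
exists (\matrix_i l i); apply/row_matrixP => i.
by rewrite row_mul rowK lE row_homog rowK.
Qed.

Lemma has_dim_hull d (V : 'M[R]_(d.+1, d)) : row_free (homog V) -> has_dim (hull V) d.
Proof.
move=> fV; split; last first.
  by move=> v _ /eqP rk; have := rank_leq_col (\matrix_(i < d.+1) (v (lift ord0 i) - v ord0)); rewrite rk ltnn.
exists (fun i => row i V); first by move=> _ [i _ <-]; exact: hull_row.
by apply/aff_indepE; rewrite (_ : \matrix_i _ = V) //; apply/row_matrixP => i; rewrite rowK.
Qed.

(** Affinely independent points of [hull V] have homogeneous coordinates
in the row space of [homog V], so there are at most [k + 1] of them. *)
Lemma dim_simplex d k (V : 'M[R]_(k.+1, d)) :
  row_free (homog V) -> has_dim (hull V) d -> k = d.
Proof.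
move=> fV [[u uV /aff_indepE fu] _]; apply/eqP; rewrite -eqSS eqn_leq; apply/andP; split.
  by move/eqP: fV => <-; exact: rank_leq_col.
have [L LE] := homog_in_hull uV; move: fu; rewrite /row_free LE => /eqP <-.
exact: leq_trans (mxrankM_maxr L (homog V)) (rank_leq_row _).
Qed.


(** An interior point can be moved slightly away from vertex [i] inside
the hull.  The [i]-th barycentric coordinate decreases strictly in this move and
remains nonnegative. *)
Lemma interior_hull_pos m d (V : 'M[R]_(m, d)) x : row_free (homog V) ->
  interior (hull V) x -> exists2 l : 'rV[R]_m, forall i, 0 < l 0 i & l *m homog V = homog x.
Proof.
move=> fV xV; have [l l0 lx] := interior_subset xV; exists l => // i.
have cvgx : x + t *: (x - row i V) @[t --> (0 : R)] --> x.
  rewrite -[X in _ --> X]addr0 -(scale0r (x - row i V)).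
  by apply: cvgD; [exact: cvg_cst | apply: cvgZr_tmp; exact: cvg_id].
have /nbhs_ballP[e /= e0 be] := cvgx _ xV.
have e2 : 0 < e / 2 by rewrite divr_gt0.
have [|k k0 kx] := be (e / 2).
  by rewrite /ball /= sub0r normrN gtr0_norm // ltr_pdivrMr // ltr_pMr // ltr1n.
have kE : k = (1 + e / 2) *: l - (e / 2) *: delta_mx 0 i.
  apply: (row_free_inj fV); rewrite /= kx mulmxBl -!scalemxAl lx -rowE row_homog.
  rewrite /homog !scale_row_mx opp_row_mx add_row_mx; congr row_mx.
    by apply/matrixP => a b; rewrite !mxE !mulr1 addrK.
  by rewrite scalerBr addrA scalerDl scale1r.
have := k0 i; rewrite kE !mxE !eqxx mulr1 subr_ge0 => /(lt_le_trans e2).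
by rewrite pmulr_rgt0 // addr_gt0.
Qed.

Lemma continuous_mulmx_coord m d (A : 'M[R]_(d, m)) i :
  continuous (fun y : 'rV[R]_d => (y *m A) 0 i : R).
Proof.
have -> : (fun y : 'rV[R]_d => (y *m A) 0 i : R) = fun y => \sum_j y 0 j * A j i.
  by apply/funext => y; rewrite mxE.
apply: continuous_big; first exact: add_continuous.
move=> j _ y; apply: cvgMr_tmp; [exact: nbhs_filter | exact: coord_continuous].
Qed.

(** The barycentric coordinates are continuous, and positivity of all of
them is an open condition that implies membership. *)
Lemma pos_interior_hull d (V : 'M[R]_(d.+1, d)) x : row_free (homog V) ->
  (exists2 l : 'rV[R]_d.+1, forall i, 0 < l 0 i & l *m homog V = homog x) ->
  interior (hull V) x.
Proof.
move=> fV [l l0 lx].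
have uV : (homog V : 'M[R]_(1 + d)) \in unitmx by rewrite -row_free_unit.
pose G : 'M[R]_(1 + d, d.+1) := invmx (homog V : 'M[R]_(1 + d)).
have GV : G *m homog V = 1%:M by exact: mulVmx uV.
have VG : homog V *m G = 1%:M by exact: mulmxV uV.
have near_pos i : \forall y \near x, 0 < (homog y *m G) 0 i.
  have GE (y : 'rV[R]_d) : (homog y *m G) 0 i = usubmx G 0 i + (y *m dsubmx G) 0 i.
    by rewrite -[in LHS](vsubmxK G) mul_row_col const_mx1_mul mxE.
  have : - usubmx G 0 i < (x *m dsubmx G) 0 i.
    by rewrite -subr_gt0 opprK addrC -GE -lx -mulmxA VG mulmx1.
  have /cvgr_gt cg := @continuous_mulmx_coord _ _ (dsubmx G) i x.
  by move=> /cg; apply: filterS => y; rewrite GE -(subr_gt0 (- _)) opprK addrC.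
have := @filter_forall _ _ (fun i y => is_true (0 < (homog y *m G) 0 i)) _ (nbhs_filter x) near_pos.
apply: filterS => y y0; exists (homog y *m G) => [i|]; first exact/ltW/y0.
by rewrite -mulmxA GV mulmx1.
Qed.

End Dim.

(** * Unimodular equivalence of lattice simplices *)

(** The units of [int] are computed to be [1] and [-1], which makes the
condition on the determinant the membership in [unitmx]. *)
Lemma unimodP n (U : 'M[int]_n) : U \in unitmx <-> \det U = 1 \/ \det U = -1.
Proof.
rewrite unitmxE -[_ \is a _]/((_ == 1) || (_ == -1)).
by split => [/orP[]/eqP->|[]->]; [left | right | |].
Qed.

Section Unimodular.
Variable R : realType.

Definition mxR m n (A : 'M[int]_(m, n)) : 'M[R]_(m, n) := map_mx intr A.

Lemma mxR_mul m n p (A : 'M[int]_(m, n)) (B : 'M[int]_(n, p)) : mxR (A *m B) = mxR A *m mxR B.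
Proof. exact: map_mxM. Qed.

Lemma mxRD m n (A B : 'M[int]_(m, n)) : mxR (A + B) = mxR A + mxR B.
Proof. exact: map_mxD. Qed.

Lemma mxR_homog m n (A : 'M[int]_(m, n)) : mxR (homog A) = homog (mxR A).
Proof. exact: map_homog. Qed.

Lemma mxR_inj m n : injective (@mxR m n).
Proof. by move=> A B /matrixP AB; apply/matrixP => i j; have := AB i j; rewrite !mxE => /intr_inj. Qed.

Lemma row_mxR m n (A : 'M[int]_(m, n)) i : row i (mxR A) = mxR (row i A).
Proof. by rewrite /mxR map_row. Qed.

Lemma mxR_const1 m n : mxR (const_mx 1 : 'M[int]_(m, n)) = const_mx 1.
Proof. by rewrite /mxR map_const_mx rmorph1. Qed.

Lemma mxR_affine m d e (V : 'M[int]_(m, d)) (U : 'M[int]_(d, e)) (w : 'rV[int]_e) :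
  mxR (V *m U + const_mx 1 *m w) = mxR V *m mxR U + const_mx 1 *m mxR w.
Proof. by rewrite mxRD !mxR_mul mxR_const1. Qed.

Lemma unimod_equiv_refl d (P : set 'rV[R]_d) : unimod_equiv P P.
Proof.
exists 1%:M, 0; split; first by left; rewrite det1.
by rewrite -[LHS]image_id; apply: eq_imagel => x _; rewrite map_mx1 map_mx0 mulmx1 addr0.
Qed.

Lemma unimod_equiv_trans d (P Q S : set 'rV[R]_d) :
  unimod_equiv P Q -> unimod_equiv Q S -> unimod_equiv P S.
Proof.
move=> [U [w [/unimodP Uu ->]]] [U' [w' [/unimodP U'u ->]]].
exists (U *m U'), (w *m U' + w'); split; first by apply/unimodP; rewrite unitmx_mul Uu.
rewrite image_comp; apply: eq_imagel => x _ /=.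
by rewrite map_mxM map_mxD map_mxM mulmxDl mulmxA addrA.
Qed.

Lemma unimod_equiv_sym d (P Q : set 'rV[R]_d) : unimod_equiv P Q -> unimod_equiv Q P.
Proof.
move=> [U [w [/unimodP Uu ->]]].
exists (invmx U), (- (w *m invmx U)); split; first by apply/unimodP; rewrite unitmx_inv.
rewrite image_comp -[LHS]image_id; apply: eq_imagel => x _ /=.
rewrite map_mxN map_mxM mulmxDl addrK -mulmxA -map_mxM mulmxV //.
by rewrite map_mx1 mulmx1.
Qed.

Lemma unimod_class_eq d (P Q : set 'rV[R]_d) :
  unimod_class P = unimod_class Q <-> unimod_equiv P Q.
Proof.
split=> [PQ|PQ].
  by rewrite -[unimod_equiv P Q]/(unimod_class P Q) PQ; exact: unimod_equiv_refl.
apply/seteqP; split=> S; apply: unimod_equiv_trans; last by [].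
exact: unimod_equiv_sym.
Qed.

Lemma unimod_equiv_hull d m (V : 'M[int]_(m, d)) (U : 'M[int]_d) (w : 'rV[int]_d) :
  U \in unitmx -> unimod_equiv (hull (mxR V)) (hull (mxR (V *m U + const_mx 1 *m w))).
Proof.
by move=> /unimodP Uu; exists U, w; split; rewrite // mxR_affine -hull_affine.
Qed.

Lemma unimod_equiv_hullP d m (V : 'M[int]_(m, d)) (Q : set 'rV[R]_d) :
  unimod_equiv (hull (mxR V)) Q ->
  exists (U : 'M[int]_d) (w : 'rV[int]_d), U \in unitmx /\ Q = hull (mxR (V *m U + const_mx 1 *m w)).
Proof.
move=> [U [w [/unimodP Uu ->]]]; exists U, w; split => //.
by rewrite hull_affine mxR_affine.
Qed.

Lemma row_free_affine d m (V : 'M[int]_(m, d)) (U : 'M[int]_d) (w : 'rV[int]_d) : U \in unitmx ->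
  row_free (homog (mxR (V *m U + const_mx 1 *m w))) = row_free (homog (mxR V)).
Proof.
move=> Uu; rewrite -mxR_homog homog_affine mxR_mul mxR_homog.
set B := block_mx _ _ _ _.
have Bu : mxR B \in unitmx.
  rewrite unitmxE /mxR det_map_mx rmorph_unit // -unitmxE.
  by rewrite unitmxE det_ublock det1 mul1r -unitmxE.
by rewrite /row_free mxrankMfree ?row_free_unit.
Qed.

Lemma row_free_homog_inj d m (V : 'M[R]_(m, d)) i j :
  row_free (homog V) -> row i V = row j V -> i = j.
Proof.
move=> fV ij; have : delta_mx 0 i = delta_mx 0 j :> 'rV[R]_m.
  by apply: (row_free_inj fV); rewrite /= -!rowE !row_homog ij.
move=> /rowP/(_ i); rewrite !mxE !eqxx /=; case: eqP => // _ /eqP.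
by rewrite oner_eq0.
Qed.

(** The rows of an affinely independent [V] are recovered from [hull V] as
its extreme points. *)
Lemma hull_eq_perm d m (V W : 'M[R]_(m, d)) :
  row_free (homog V) -> row_free (homog W) -> hull V = hull W ->
  exists s : {perm 'I_m}, W = row_perm s V.
Proof.
move=> fV fW VW.
have /choice[f fE] : forall i, exists j, row i W = row j V.
  by move=> i; apply: vertices_hull_sub; rewrite VW; exact: vertices_hull.
have f_inj : injective f.
  by move=> i j fij; apply: (row_free_homog_inj fW); rewrite !fE fij.
exists (perm f_inj); apply/row_matrixP => i.
by rewrite fE; apply/rowP => j; rewrite !mxE permE.
Qed.

Lemma lattice_row m d (V : 'M[int]_(m, d)) i : lattice R d (row i (mxR V)).
Proof. by exists (row i V) => //; rewrite row_mxR. Qed.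

Lemma lattice_polytope_hull m d (V : 'M[int]_(m, d)) : lattice_polytope (hull (mxR V)).
Proof.
split; last by move=> x /vertices_hull_sub[i ->]; exact: lattice_row.
exists (range (fun i => row i (mxR V))); first exact: finite_image.
by rewrite conv_range; congr hull; apply/row_matrixP => i; rewrite rowK.
Qed.

(** The vertices of a simplex are its extreme points, so it is a lattice
polytope exactly when these are integral. *)
Lemma lattice_simplexP d (P : set 'rV[R]_d) :
  [/\ lattice_polytope P, simplex P & has_dim P d] <->
  exists2 V : 'M[int]_(d.+1, d), row_free (homog (mxR V)) & P = hull (mxR V).
Proof.
split=> [[[_ latP] [k [v /aff_indepE fv PE]] dimP]|[V fV ->]]; last first.
  split; [exact: lattice_polytope_hull | | exact: has_dim_hull].
  have VE : \matrix_i row i (mxR V) = mxR V by apply/row_matrixP => i; rewrite rowK.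
  exists d, (fun i => row i (mxR V)); first by apply/aff_indepE; rewrite VE.
  by rewrite conv_range VE.
move: PE; rewrite conv_range => PE; rewrite PE in latP dimP *.
have kd := dim_simplex fv dimP; rewrite kd in v fv PE latP dimP *.
have /choice[z zE] : forall i, exists z : 'rV[int]_d, v i = mxR z.
  move=> i; have [|z _ <-] := latP (v i); last by exists z.
  by rewrite -(rowK v); exact: vertices_hull.
have VE : \matrix_i v i = mxR (\matrix_i z i).
  by apply/row_matrixP => i; rewrite row_mxR !rowK.
by exists (\matrix_i z i); rewrite -VE.
Qed.

End Unimodular.

(** * Lattice pyramids *)

(** A primitive functional [g] and a vector [p] with [p *m g = 1] can be
made the last coordinate and the last basis vector.  The Smith normal form moves
[g] to the last coordinate; then a transvection fixing [g] moves the last basis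
vector to [p]. *)
Lemma unimodular_completion n (g : 'cV[int]_n.+1) (p : 'rV[int]_n.+1) : p *m g = 1%:M ->
  exists B : 'M[int]_n.+1,
    [/\ B \in unitmx, B *m g = delta_mx ord_max 0 & row ord_max B = p].
Proof.
move=> pg; have [L Lu [T _ [e _ gE]]] := int_Smith_normal_form g.
pose u := e`_0 * T 0 0.
have {}gE : g = u *: (L *m delta_mx 0 0).
  rewrite gE -mulmxA scalemxAr; congr (_ *m _).
  apply/colP => i; rewrite !mxE big_ord1 !mxE eqxx andbT.
  rewrite -[_ == _ :> nat]/(i == 0); case: eqP => [->|_]; last by rewrite mulr0n mul0r mulr0.
  by rewrite mulr1n mulr1.
have uu : u * u = 1.
  have us : u * (p *m (L *m (delta_mx 0 0 : 'cV[int]_n.+1))) 0 0 = 1.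
    have /matrixP/(_ 0 0) : u *: (p *m (L *m delta_mx 0 0)) = 1%:M by rewrite scalemxAr -gE.
    by rewrite mxE [RHS]mxE.
  have : u \is a GRing.unit by apply/unitrP; eexists; rewrite mulrC; split; exact: us.
  rewrite -[_ \is a _]/((u == 1) || (u == -1)).
  by case/orP => /eqP ->; rewrite ?mulr1 // mulrNN mulr1.
(* The scalar [u] is its own inverse, so [M] maps [g] to the last unit vector. *)
pose M := u *: (tperm_mx 0 ord_max *m invmx L).
have Mg : M *m g = delta_mx ord_max 0.
  rewrite gE /M -scalemxAr -scalemxAl scalerA uu scale1r -mulmxA mulKmx //.
  rewrite -xrowE; apply/colP => i; rewrite !mxE eqxx !andbT.
  by congr (_%:R); rewrite (canF_eq (tpermK 0 ord_max)) tpermL.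
have Mu : M \in unitmx.
  rewrite unitmxZ ?unitmx_mul ?unitmx_inv ?Lu ?unitmx_perm //.
  by apply/unitrP; exists u.
pose a := p *m invmx M - delta_mx 0 ord_max.
have a0 : a *m (delta_mx ord_max 0 : 'cV[int]_n.+1) = 0.
  rewrite mulmxBl mul_delta_mx -Mg -mulmxA mulKmx // pg.
  by rewrite [delta_mx _ _]mx11_scalar mxE eqxx subrr.
(* As [a] kills the last unit vector, the first factor is a transvection. *)
pose B := (1%:M + delta_mx ord_max 0 *m a) *m M.
exists B; split.
- rewrite unitmx_mul Mu andbT.
  have /mulmx1_unit[] // : (1%:M + delta_mx ord_max 0 *m a) *m (1%:M - delta_mx ord_max 0 *m a) = 1%:M.
  by rewrite mulmxBr mulmx1 mulmxDl mul1mx -mulmxA [a *m _]mulmxA a0 mul0mx mulmx0 addr0 addrK.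
- by rewrite -mulmxA Mg mulmxDl mul1mx -mulmxA a0 mulmx0 addr0.
- rewrite rowE mulmxA mulmxDr mulmx1 mulmxA mul_delta_mx.
  have -> : delta_mx 0 0 = 1%:M :> 'M[int]_1 by apply/matrixP => i j; rewrite !ord1 !mxE.
  by rewrite mul1mx subrKC mulmxKV.
Qed.

Lemma row_free_row' (F : fieldType) m n (A : 'M[F]_(m.+1, n)) i :
  row_free A -> row_free (row' i A).
Proof.
move=> fA; apply: inj_row_free => l l0.
pose l' : 'rV[F]_m.+1 := \row_j (if unlift i j is Some k then l 0 k else 0).
have /(row_free_inj fA)/rowP l'0 : l' *m A = 0 *m A.
  rewrite mul0mx -[RHS]l0 !mulmx_sum_row (bigD1_ord i) //= mxE unlift_none scale0r add0r.
  by apply: eq_bigr => j _; rewrite mxE liftK; congr (_ *: _); apply/rowP => k; rewrite !mxE.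
by apply/rowP => j; have := l'0 (lift i j); rewrite !mxE liftK.
Qed.

Section Pyramids.
Variable R : realType.

Definition embed0_mx d : 'M[R]_(d, d.+1) := \matrix_(a, b) (b == lift ord_max a)%:R.

Lemma embed0E d (x : 'rV[R]_d) : embed0 x = x *m embed0_mx d.
Proof.
apply/rowP => j; rewrite !mxE; case: unliftP => [i ->|->].
  rewrite (bigD1 i) //= !mxE eqxx mulr1 big1 ?addr0 // => k ki.
  by rewrite mxE (inj_eq lift_inj) eq_sym (negbTE ki) mulr0.
by rewrite big1 // => k _; rewrite mxE (negbTE (neq_lift _ _)) mulr0.
Qed.

(** The index of [iterated_Pyr] is generalised so that the inversion can
be done by plain case analysis. *)
Lemma iterated_PyrP d (Q : set 'rV[R]_d.+1) : iterated_Pyr Q -> exists Q', Q = Pyr Q'.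
Proof.
pose T n : set 'rV[R]_n -> Prop :=
  if n is m.+1 return set 'rV[R]_n -> Prop then fun Q => exists Q', Q = Pyr Q' else fun=> True.
suff H n (S : set 'rV[R]_n) : iterated_Pyr S -> T n S by exact: (H d.+1).
by case=> m S' *; exists S'.
Qed.

(** After an equivalence with a pyramid over [Q], every vertex lies in
the hyperplane of [Q] or is the apex, because extreme points of a convex hull
belong to the generating set.  Some vertex is the apex by affine independence,
and the last coordinate is the functional sought. *)
Lemma lattice_pyramid_facet d (V : 'M[int]_(d.+2, d.+1)) :
  row_free (homog (mxR R V)) -> lattice_pyramid (hull (mxR R V)) ->
  exists i (f : 'cV[int]_(1 + d.+1)), homog V *m f = delta_mx i 0.
Proof.
move=> fV [_ /iterated_PyrP[Q ->] /unimod_equiv_hullP[U [w [Uu QE]]]].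
set W := V *m U + _ in QE.
have fW : row_free (homog (mxR R W)) by rewrite row_free_affine.
have rowW j : row j (mxR R W) = delta_mx 0 ord_max \/ W j ord_max = 0.
  have : vertices (Pyr Q) (row j (mxR R W)) by rewrite QE; exact: vertices_hull.
  move=> /vertices_conv[[x _ /rowP/(_ ord_max)]|->]; last by left.
  by rewrite !mxE unlift_none => /esym/eqP; rewrite intr_eq0 => /eqP ?; right.
have [i Wi] : exists i, row i (mxR R W) = delta_mx 0 ord_max.
  apply: contrapT => none.
  have W0 : mxR R W *m delta_mx ord_max 0 = 0 :> 'cV[R]_d.+2.
    rewrite -colE; apply/colP => j; rewrite mxE [LHS]mxE [RHS]mxE.
    by case: (rowW j) => [Wj|->//]; case: none; exists j.
  have uW : (homog (mxR R W) : 'M[R]_(1 + d.+1)) \in unitmx by rewrite -row_free_unit.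
  have : (homog (mxR R W) : 'M[R]_(1 + d.+1)) *m col_mx 0 (delta_mx ord_max 0 : 'cV[R]_d.+1) = 0.
    by rewrite mul_row_col mulmx0 add0r W0.
  move=> /(congr1 (mulmx (invmx (homog (mxR R W) : 'M[R]_(1 + d.+1))))).
  rewrite mulKmx // mulmx0 => /eqP; rewrite col_mx_eq0 => /andP[_ /eqP/colP/(_ ord_max)].
  by rewrite !mxE !eqxx => /eqP; rewrite oner_eq0.
have WE : W *m delta_mx ord_max 0 = delta_mx i 0 :> 'cV[int]_d.+2.
  rewrite -colE; apply/colP => j; rewrite mxE [RHS]mxE eqxx andbT.
  have [->|ji] := eqVneq j i.
    move/rowP/(_ ord_max): Wi; rewrite mxE [LHS]mxE [RHS]mxE !eqxx.
    exact: (@intr_inj R _ 1).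
  case: (rowW j) => [Wj|->//]; case/eqP: ji.
  by apply: (row_free_homog_inj fW); rewrite Wi Wj.
pose e : 'cV[int]_d.+1 := delta_mx ord_max 0.
exists i, (col_mx (w *m e) (U *m e)).
by rewrite mul_row_col !mulmxA -mulmxDl addrC.
Qed.

(** An integral functional that is one at vertex [i] and zero at the
others is made the last coordinate by a unimodular change of basis which also
sends the edge from another vertex to vertex [i] to the last basis vector. *)
Lemma facet_lattice_pyramid d (V : 'M[int]_(d.+2, d.+1)) i (f : 'cV[int]_(1 + d.+1)) :
  row_free (homog (mxR R V)) -> homog V *m f = delta_mx i 0 -> lattice_pyramid (hull (mxR R V)).
Proof.
move=> fV; rewrite -(vsubmxK f) mul_row_col; set c := usubmx f; set g := dsubmx f => Vf.
have Vg j : (row j V *m g) 0 0 = (j == i)%:R - c 0 0.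
  have /colP/(_ j) := Vf; rewrite !mxE eqxx andbT big_ord1 !mxE mul1r => <-.
  by rewrite addrC addrK; apply: eq_bigr => k _; rewrite mxE.
pose k := lift i ord0; have ki : k == i = false by rewrite eq_sym (negbTE (neq_lift _ _)).
pose p := row i V - row k V.
have pg : p *m g = 1%:M.
  by rewrite [LHS]mx11_scalar mulmxBl mxE [X in _ + X]mxE !Vg eqxx ki opprB addrA subrK subr0.
have [B [Bu Bg Bp]] := unimodular_completion pg.
pose U := invmx B; have Uu : U \in unitmx by rewrite unitmx_inv.
pose w := - (row k V *m U); pose W := V *m U + const_mx 1 *m w.
have WjE j : row j W = (row j V - row k V) *m U.
  rewrite /W linearD /= row_mul row_mul mulmxBl /w; congr (_ + _).
  by apply/rowP => a; rewrite !mxE big_ord1 !mxE mul1r.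
have Wi : row i W = delta_mx 0 ord_max.
  by rewrite WjE -/p -Bp rowE mulmxK.
have Wmax j : W j ord_max = (j == i)%:R.
  have <- : (row j W *m (delta_mx ord_max 0 : 'cV[int]_d.+1)) 0 0 = W j ord_max.
    by rewrite -colE mxE [LHS]mxE.
  rewrite WjE -Bg -mulmxA mulKmx // mulmxBl mxE [X in _ + X]mxE !Vg ki.
  by rewrite opprB addrA subrK subr0.
have fW : row_free (homog (mxR R W)) by rewrite row_free_affine.
have eqW : unimod_equiv (hull (mxR R V)) (hull (mxR R W)) by exact: unimod_equiv_hull.
clearbody W; clear WjE.
pose V' := col' ord_max (row' i W).
have V'E : row' i (mxR R W) = mxR R V' *m embed0_mx d.
  apply/row_matrixP => j; rewrite row_mul -embed0E; apply/rowP => a; rewrite !mxE.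
  by case: unliftP => [b ->|->]; rewrite ?mxE // Wmax eq_sym (negbTE (neq_lift _ _)).
exists (hull (mxR R W)); last exact: eqW.
have -> : hull (mxR R W) = Pyr (hull (mxR R V')).
  have rowW' j : row (lift i j) (mxR R W) = embed0 (row j (mxR R V')).
    by rewrite embed0E -row_mul -V'E; apply/rowP => a; rewrite !mxE.
  have rowWi : row i (mxR R W) = delta_mx 0 ord_max by rewrite row_mxR Wi /mxR map_delta_mx.
  apply/seteqP; split.
    apply: hull_sub; first exact: conv_convex.
    move=> j; apply: sub_gen_smallest; case: (unliftP i j) => [a ->|->]; last by right.
    by left; exists (row a (mxR R V')); [exact: hull_row | rewrite rowW'].
  apply: smallest_sub; first exact: convex_hull.
  move=> _ [[x + <-]|->]; last by rewrite -rowWi; exact: hull_row.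
  suff: hull (mxR R V') `<=` [set x | hull (mxR R W) (embed0 x)] by move=> /[apply].
  apply: hull_sub; last by move=> j /=; rewrite -rowW'; exact: hull_row.
  apply/convex_setP => y z t /= Wy Wz t01.
  rewrite embed0E mulmxDl -!scalemxAl -!embed0E.
  by have cW := @convex_hull _ _ _ (mxR R W); move/convex_setP: cW; apply.
apply: Pyr_once; first exact: lattice_polytope_hull.
apply: has_dim_hull.
have := row_free_row' i fW; rewrite (_ : row' i (homog _) = homog (row' i (mxR R W))); last first.
  by apply/matrixP => a b; rewrite !mxE; case: fintype.split => ?; rewrite !mxE.
rewrite V'E -[_ *m embed0_mx d]addr0 -[in X in _ + X](mulmx0 _ (const_mx 1 : 'cV[R]_d.+1)).
rewrite homog_affine /row_free => /eqP rk.
rewrite eqn_leq rank_leq_row /=; apply: leq_trans (mxrankM_maxl _ _).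
exact: (eq_leq (esym rk)).
Qed.

End Pyramids.

(** * The polar dual of a simplex *)

Section Polar.
Variable R : realType.

Lemma homog_unit d (W : 'M[R]_(d.+1, d)) :
  row_free (homog W) = ((homog W : 'M[R]_(1 + d)) \in unitmx).
Proof. exact: row_free_unit. Qed.

Lemma mulmx_col_inj d e (W : 'M[R]_(d.+1, d)) (A B : 'M[R]_(d, e)) :
  row_free (homog W) -> W *m A = W *m B -> A = B.
Proof.
rewrite homog_unit => uW AB.
have /(congr1 (mulmx (invmx (homog W : 'M[R]_(1 + d))))) :
    (homog W : 'M[R]_(1 + d)) *m col_mx 0 A = homog W *m col_mx 0 B.
  by rewrite !mul_row_col !mulmx0 AB.
by rewrite !mulKmx // => /eq_col_mx[].
Qed.

Lemma mul_homog_scale m d (a : R) (V : 'M[R]_(m, d)) (l : 'rV[R]_m) (x : 'rV[R]_d) : a != 0 ->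
  l *m homog (a *: V) = homog x <-> (a *: l) *m homog V = row_mx a%:M x.
Proof.
move=> a0; rewrite /homog !mul_mx_row -scalemxAl -scalemxAl -scalemxAr.
split=> /eq_row_mx[lE ->]; congr row_mx.
  by rewrite lE; apply/matrixP => i j; rewrite !ord1 !mxE mulr1.
apply: (scalerI a0); rewrite lE; apply/matrixP => i j.
by rewrite !ord1 !mxE mulr1.
Qed.

Lemma row_free_homog_scale m d (a : R) (V : 'M[R]_(m, d)) : a != 0 ->
  row_free (homog V) -> row_free (homog (a *: V)).
Proof.
move=> a0 fV; apply: inj_row_free => l l0.
apply: (row_free_inj fV); rewrite /= mul0mx.
move: l0; rewrite /homog !mul_mx_row -[0]row_mx0 -scalemxAr => /eq_row_mx[-> /eqP].
by rewrite scaler_eq0 (negbTE a0) => /eqP ->.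
Qed.

(** Here [l] is the vector of barycentric coordinates of the origin.  The
[j]-th column of [Y] is the point where all the inequalities [W i . y <= 1] with
[i <> j] are equalities; its value at [W j] is forced by [l *m W = 0].  A point
[y] of the dual with slacks [s j = 1 - W j . y] has barycentric coordinates
[l j * s j] with respect to these points. *)
Lemma polar_dual_hull d (W : 'M[R]_(d.+1, d)) (l : 'rV[R]_d.+1) (Y : 'M[R]_(d, d.+1)) :
  row_free (homog W) -> (forall i, 0 < l 0 i) -> l *m homog W = homog 0 ->
  W *m Y = const_mx 1 - diag_mx (map_mx GRing.inv l) ->
  polar_dual (hull W) = hull Y^T.
Proof.
move=> fW l0 /mul_homogE[/(_ 0) sl lW] WY.
have dotE (x y : 'rV[R]_d) : \sum_(i < d) x 0 i * y 0 i = (x *m y^T) 0 0.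
  by rewrite mxE; apply: eq_bigr => i _; rewrite mxE.
have constE (k : 'rV[R]_d.+1) : \sum_j k 0 j = 1 -> const_mx 1 *m k^T = const_mx 1 :> 'cV[R]_d.+1.
  move=> sk; apply/colP => i; rewrite !mxE -[RHS]sk.
  by apply: eq_bigr => j _; rewrite !mxE mul1r.
apply/seteqP; split => y.
  move=> /= Wy1.
  have s0 j : 0 <= 1 - (W *m y^T) j 0.
    by have := Wy1 _ (hull_row W j); rewrite dotE -row_mul mxE subr_ge0.
  pose k := \row_j (l 0 j * (1 - (W *m y^T) j 0)).
  have sk : \sum_j k 0 j = 1.
    transitivity (1 - (l *m W *m y^T) 0 0); last by rewrite lW mul0mx mxE subr0.
    rewrite -sl -mulmxA [X in _ - X]mxE -sumrB; apply: eq_bigr => j _.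
    by rewrite mxE mulrBr mulr1.
  exists k; first by move=> j; rewrite mxE mulr_ge0 // ltW.
  apply/mul_homogE; split; first by move=> i; rewrite ord1.
  apply: trmx_inj; rewrite trmx_mul trmxK; apply: (mulmx_col_inj fW).
  rewrite mulmxA WY mulmxBl constE // mul_diag_mx; apply/colP => j.
  by rewrite !mxE mulrA mulVf ?gt_eqF // mul1r opprB addrC subrK.
move=> [k k0 /mul_homogE[/(_ 0) sk <-]] _ [p p0 /mul_homogE[/(_ 0) sp <-]] /=.
rewrite dotE trmx_mul trmxK -mulmxA (mulmxA W) WY mulmxBl constE // mulmxBr mxE.
have -> : (p *m const_mx 1 : 'M[R]_1) 0 0 = 1.
  by rewrite mxE -[RHS]sp; apply: eq_bigr => j _; rewrite mxE mulr1.
rewrite mxE gerDl oppr_le0 mxE sumr_ge0 // => j _.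
by rewrite mul_diag_mx !mxE !mulr_ge0 // invr_ge0 ltW.
Qed.

Lemma polar_dual_row_free d (W : 'M[R]_(d.+1, d)) (l : 'rV[R]_d.+1) (Y : 'M[R]_(d, d.+1)) :
  (forall i, 0 < l 0 i) -> W *m Y = const_mx 1 - diag_mx (map_mx GRing.inv l) ->
  row_free (homog Y^T).
Proof.
move=> l0 WY; apply: inj_row_free => k /(congr1 trmx).
rewrite trmx_mul /homog tr_row_mx trmxK trmx_const trmx0 => k0.
have : homog (- W) *m (col_mx (const_mx 1) Y *m k^T) = 0 by rewrite k0 mulmx0.
rewrite mulmxA mul_row_col mulNmx WY opprB.
have -> : (const_mx 1 : 'cV[R]_d.+1) *m (const_mx 1 : 'rV_d.+1) = const_mx 1.
  by apply/matrixP => i j; rewrite !mxE big_ord1 !mxE mulr1.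
rewrite subrKC mul_diag_mx => /colP dk; apply/rowP => i.
by have /eqP := dk i; rewrite !mxE mulf_eq0 invr_eq0 gt_eqF //= => /eqP.
Qed.

(** The column [j] of [invmx (homog W)] is the [j]-th barycentric
coordinate as an affine functional, with constant term [l j]; dividing its linear
part by [- l j] gives the vertex of the dual. *)
Lemma polar_dual_rows d (W : 'M[R]_(d.+1, d)) (l : 'rV[R]_d.+1) :
  row_free (homog W) -> (forall i, 0 < l 0 i) -> l *m homog W = homog 0 ->
  exists Y : 'M[R]_(d, d.+1), W *m Y = const_mx 1 - diag_mx (map_mx GRing.inv l).
Proof.
move=> fW l0 lW; have uW := fW; rewrite homog_unit in uW.
pose G : 'M[R]_(1 + d, d.+1) := invmx (homog W : 'M[R]_(1 + d)).
have WG : homog W *m G = 1%:M by exact: mulmxV uW.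
have uG : usubmx G = l.
  rewrite -[l]mulmx1 -WG mulmxA lW -{2}(vsubmxK G) mul_row_col mul0mx addr0.
  by rewrite const_mx1_mul.
exists (- (dsubmx G *m diag_mx (map_mx GRing.inv l))).
have dG : W *m dsubmx G = 1%:M - const_mx 1 *m l.
  by rewrite -WG -{2}(vsubmxK G) mul_row_col uG addrC addKr.
rewrite mulmxN mulmxA dG mulmxBl mul1mx opprB -mulmxA; congr (_ - _).
rewrite mul_mx_diag; apply/matrixP => i j.
by rewrite !mxE big_ord1 !mxE mul1r divff // gt_eqF.
Qed.

End Polar.

(** * Gorenstein simplices *)

(** The columns of [N] are the affine functionals vanishing on the facets,
[m i] is the value of the [i]-th one at vertex [i], and [z], at level [r], is the
lattice point at distance one from all facets of the cone over the simplex.  The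
last equation makes every column of [N] primitive. *)
Definition gorenstein_normals d (V : 'M[int]_(d.+1, d)) (r : nat) (z : 'rV[int]_d)
    (N : 'M[int]_(1 + d, d.+1)) (m : 'rV[int]_d.+1) : Prop :=
  [/\ forall i, 0 < m 0 i, homog V *m N = diag_mx m & row_mx r%:Z%:M z *m N = const_mx 1].

Section Gorenstein.
Variable R : realType.

Lemma mxR_diag n (m : 'rV[int]_n) : mxR R (diag_mx m) = diag_mx (mxR R m).
Proof. by rewrite /mxR map_diag_mx. Qed.

Lemma mxR_row_mx m n p (A : 'M[int]_(m, n)) (B : 'M[int]_(m, p)) :
  mxR R (row_mx A B) = row_mx (mxR R A) (mxR R B).
Proof. exact: map_row_mx. Qed.

Lemma mxR_natM r : mxR R r%:Z%:M = r%:R%:M :> 'M[R]_1.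
Proof. by rewrite /mxR map_scalar_mx. Qed.

Lemma mxR_natZ r m n (A : 'M[int]_(m, n)) : mxR R (r%:Z *: A) = r%:R *: mxR R A.
Proof. exact: map_mxZ. Qed.

Section Normals.
Variables (d r : nat) (V : 'M[int]_(d.+1, d)) (z : 'rV[int]_d).
Variables (N : 'M[int]_(1 + d, d.+1)) (m : 'rV[int]_d.+1).
Hypothesis normals : gorenstein_normals V r z N m.

Let mu : 'rV[R]_d.+1 := map_mx GRing.inv (mxR R m).

Lemma normals_weight_gt0 i : 0 < (m 0 i)%:~R :> R.
Proof. by case: normals => m0 _ _; rewrite ltr0z. Qed.

Lemma normals_free : row_free (homog (mxR R V)).
Proof.
apply: inj_row_free => l l0; case: normals => m0 /(congr1 (@mxR R _ _)) VN _.
rewrite mxR_mul mxR_homog mxR_diag in VN.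
have /eqP : l *m diag_mx (mxR R m) = 0 by rewrite -VN mulmxA l0 mul0mx.
rewrite mul_mx_diag => /eqP/rowP lm; apply/rowP => i.
by have /eqP := lm i; rewrite !mxE mulf_eq0 (gt_eqF (normals_weight_gt0 i)) orbF => /eqP.
Qed.

(** Both sides have the same product with the invertible matrix [N]: the
weights [1 / m i] are the coefficients of the Gorenstein point with respect to
the vertices. *)
Lemma normals_center : mu *m homog (mxR R V) = row_mx r%:R%:M (mxR R z).
Proof.
case: normals => m0 /(congr1 (@mxR R _ _)) VN /(congr1 (@mxR R _ _)).
rewrite mxR_mul mxR_homog mxR_diag in VN; rewrite mxR_mul mxR_row_mx mxR_natM mxR_const1 => zN.
have fV := normals_free; rewrite homog_unit in fV.
set rz := row_mx _ _ in zN *.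
have /(congr1 (mulmx rz)) := mulVmx fV.
rewrite mulmx1 mulmxA => <-; congr (_ *m _).
set p := rz *m _; have pV : p *m homog (mxR R V) = rz by rewrite /p mulmxKV.
move: zN; rewrite -pV -mulmxA VN mul_mx_diag => /rowP pm; apply/rowP => i.
have mi0 : mxR R m 0 i != 0 by rewrite mxE gt_eqF // normals_weight_gt0.
by apply: (mulIf mi0); have := pm i; rewrite [LHS]mxE [RHS]mxE => ->; rewrite mxE mulVf.
Qed.

(** This is the leading coordinate of [normals_center]. *)
Lemma sum_inv_weights : \sum_i (m 0 i)%:~R^-1 = r%:R :> R.
Proof.
have := normals_center; rewrite mul_mx_row => /eq_row_mx[/matrixP/(_ 0 0) + _].
by rewrite !mxE mulr1n => <-; apply: eq_bigr => i _; rewrite !mxE mulr1.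
Qed.

(** At an interior lattice point of the [n]-th dilate each facet functional
is a positive integer, hence at least one, so the [i]-th coefficient is at least
[1 / m i]; these coefficients add up to [n].  The Gorenstein point attains the
bound. *)
Lemma normals_codegree : (0 < r)%N -> codegree (hull (mxR R V)) = r.
Proof.
move=> r0; have rN0 : r%:R != 0 :> R by rewrite pnatr_eq0 -lt0n.
set S := [set n : nat | (0 < n)%N /\ interior (dilate n (hull (mxR R V))) `&` lattice R d !=set0].
have Sr : S r.
  split=> //; exists (mxR R z); split; last by exists z.
  rewrite dilate_hull; apply: pos_interior_hull; first exact: row_free_homog_scale normals_free.
  exists (r%:R^-1 *: mu) => [i|].
    by rewrite !mxE mulr_gt0 ?invr_gt0 ?ltr0n // normals_weight_gt0.
  by apply/mul_homog_scale => //; rewrite scalerA divff // scale1r normals_center.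
have Smin n : S n -> (r <= n)%N.
  move=> [n0 [x [+ [y _ yx]]]]; rewrite -{}yx.
  have nN0 : n%:R != 0 :> R by rewrite pnatr_eq0 -lt0n.
  rewrite dilate_hull => /interior_hull_pos[|l l0 /mul_homog_scale lV].
    exact: row_free_homog_scale normals_free.
  have {}lV := lV nN0; set k := n%:R *: l in lV.
  have k0 i : 0 < k 0 i by rewrite mxE mulr_gt0 ?ltr0n.
  have km i : k 0 i * (m 0 i)%:~R = ((row_mx n%:Z%:M y *m N) 0 i)%:~R.
    have <- : mxR R (row_mx n%:Z%:M y *m N) 0 i = ((row_mx n%:Z%:M y *m N) 0 i)%:~R by rewrite mxE.
    rewrite mxR_mul mxR_row_mx mxR_natM -lV -mulmxA -mxR_homog -mxR_mul.
    by case: normals => _ -> _; rewrite mxR_diag mul_mx_diag [RHS]mxE [mxR R m _ _]mxE.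
  (* [k 0 i * m 0 i] is a positive integer. *)
  have k1 i : (m 0 i)%:~R^-1 <= k 0 i.
    rewrite -[X in X <= _]mul1r ler_pdivrMr ?normals_weight_gt0 // km.
    rewrite -[1]/(1%:~R) ler_int -gtz0_ge1 -(ltr0z R) -km.
    by rewrite mulr_gt0 // normals_weight_gt0.
  rewrite -(ler_nat R) -sum_inv_weights.
  have <- : \sum_i k 0 i = n%:R.
    move: lV; rewrite mul_mx_row => /eq_row_mx[/matrixP/(_ 0 0) + _].
    by rewrite !mxE mulr1n => <-; apply: eq_bigr => i _; rewrite !mxE mulr1.
  exact: ler_sum.
rewrite /codegree; apply: xget_unique => /=; first by split.
by move=> n [Sn nmin]; apply/eqP; rewrite eqn_leq nmin // Smin.
Qed.

End Normals.

(** Translate the [r]-th dilate by [- z].  The vertices of the polar dual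
are then the linear parts of [- N]. *)
Lemma normals_gorenstein d r (V : 'M[int]_(d.+1, d)) z N m : (0 < r)%N ->
  gorenstein_normals V r z N m -> gorenstein (hull (mxR R V)).
Proof.
move=> r0 H; have fV := normals_free H; have center := normals_center H.
have rN0 : r%:R != 0 :> R by rewrite pnatr_eq0 -lt0n.
have m0 := normals_weight_gt0 H.
split; [exact: lattice_polytope_hull | exact: has_dim_hull |].
pose W : 'M[int]_(d.+1, d) := (r%:Z *: V) *m 1%:M + const_mx 1 *m (- z).
have dilE : dilate r (hull (mxR R V)) = hull (mxR R (r%:Z *: V)).
  by rewrite dilate_hull /mxR map_mxZ.
exists r, (hull (mxR R W)); split; [by []| |by rewrite dilE; exact: unimod_equiv_hull (unitmx1 _ _)].
have fW : row_free (homog (mxR R W)).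
  rewrite row_free_affine ?unitmx1 // /mxR map_mxZ.
  exact: row_free_homog_scale.
pose l : 'rV[R]_d.+1 := r%:R^-1 *: map_mx GRing.inv (mxR R m).
have l0 i : 0 < l 0 i by rewrite !mxE mulr_gt0 ?invr_gt0 ?ltr0n.
have lW : l *m homog (mxR R W) = homog 0.
  apply/mul_homogE; split=> [i|].
    rewrite ord1 -[RHS](mulVf rN0) -{2}(sum_inv_weights H) mulr_sumr.
    by apply: eq_bigr => j _; rewrite !mxE.
  have := center; rewrite mul_mx_row => /eq_row_mx[s1 sV].
  rewrite mxR_affine mulmxDr {2}/mxR map_mx1 mulmx1 mulmxA /mxR map_mxZ -!scalemxAl -scalemxAr.
  rewrite scalerA mulVf // scale1r -/(mxR R V) sV s1 map_mxN mulmxN mul_scalar_mx scalerN.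
  by rewrite scalerA mulVf // scale1r subrr.
pose Y := - dsubmx N.
have WY : mxR R W *m mxR R Y = const_mx 1 - diag_mx (map_mx GRing.inv l).
  have [_ VN zN] := H.
  have WYz : W *m Y = const_mx 1 - diag_mx (r%:Z *: m).
    rewrite /W /Y mulmx1 mulmxDl -scalemxAl !mulmxN mulNmx opprK.
    have -> : V *m dsubmx N = diag_mx m - const_mx 1 *m usubmx N.
      by rewrite -VN -{2}(vsubmxK N) mul_row_col addrAC subrr add0r.
    have -> : const_mx 1 = const_mx 1 *m (row_mx r%:Z%:M z *m N) :> 'M[int]_d.+1.
      by rewrite zN; apply/matrixP => i j; rewrite !mxE big_ord1 !mxE mulr1.
    rewrite -{3}(vsubmxK N) mul_row_col mulmxDr mul_scalar_mx -scalemxAr -mulmxA.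
    rewrite scalerN scalerBr opprB addrAC; congr (_ - _).
    by apply/matrixP => i j; rewrite !mxE mulrnAr.
  rewrite -mxR_mul WYz /mxR map_mxB -/(mxR R (const_mx 1)) mxR_const1 map_diag_mx; congr (_ - diag_mx _).
  by apply/rowP => i; rewrite !mxE invfM !invrK rmorphM.
split; [exact: lattice_polytope_hull | exact: has_dim_hull | |].
  by apply: pos_interior_hull => //; exists l.
rewrite (polar_dual_hull fW l0 lW WY) /mxR map_trmx.
exact: lattice_polytope_hull.
Qed.

(** The vertices [y i] of the polar dual of the reflexive polytope are
integral.  Pulled back along the equivalence and the dilation, [1 - y i] becomes
[r] times an affine functional that vanishes on all vertices except the [i]-th.
Its linear part is integral, and its constant term is integral because it
vanishes at some lattice vertex. *)
Lemma gorenstein_normalsP d (V : 'M[int]_(d.+2, d.+1)) :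
  row_free (homog (mxR R V)) -> gorenstein (hull (mxR R V)) ->
  exists r z N m, (0 < r)%N /\ gorenstein_normals V r z N m.
Proof.
move=> fV [_ _ [r [Q [r0 [_ _ Q0 [_ latQ]] eqQ]]]].
have rN0 : r%:R != 0 :> R by rewrite pnatr_eq0 -lt0n.
have dilE : dilate r (hull (mxR R V)) = hull (mxR R (r%:Z *: V)).
  by rewrite dilate_hull /mxR map_mxZ.
move: eqQ; rewrite dilE => /unimod_equiv_hullP[U [w [Uu QE]]].
set W := _ + _ in QE; rewrite QE in Q0 latQ.
have fW : row_free (homog (mxR R W)).
  rewrite row_free_affine // /mxR map_mxZ; exact: row_free_homog_scale.
have [l l0 lW] := interior_hull_pos fW Q0.
have [Y WY] := polar_dual_rows fW l0 lW.
rewrite (polar_dual_hull fW l0 lW WY) in latQ.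
have /choice[y yE] : forall i, exists y : 'rV[int]_d.+1, row i Y^T = mxR R y.
  move=> i; have [|y _ <-] := latQ (row i Y^T); last by exists y.
  by apply: vertices_hull; exact: polar_dual_row_free l0 WY.
pose Yz : 'M[int]_(d.+1, d.+2) := (\matrix_i y i)^T.
have YE : Y = mxR R Yz.
  apply: trmx_inj; rewrite /mxR map_trmx trmxK; apply/row_matrixP => i.
  by rewrite yE row_mxR rowK.
pose g := - (U *m Yz).
(* The constant term of column [i] is read off at a vertex other than [i]. *)
pose c : 'rV[int]_d.+2 := \row_(i < d.+2) - (V *m g) (lift i ord0) i.
pose N : 'M[int]_(1 + d.+1, d.+2) := col_mx c g.
pose m : 'rV[int]_d.+2 := \row_i ((V *m g) i i + c 0 i).
pose cR : 'rV[R]_d.+2 := r%:R^-1 *: (const_mx 1 - mxR R (w *m Yz)).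
have Vg : mxR R (V *m g) = diag_mx (map_mx GRing.inv (r%:R *: l)) - const_mx 1 *m cR.
  apply: (scalerI rN0).
  have : mxR R (W *m Yz) = const_mx 1 - diag_mx (map_mx GRing.inv l) by rewrite mxR_mul -YE.
  rewrite /W mulmxDl -!scalemxAl -!mulmxA -[U *m Yz]opprK -/g mulmxN.
  rewrite mxRD {1}/mxR map_mxZ map_mxN -/(mxR R (V *m g)) (mxR_mul _ (const_mx 1)) mxR_const1.
  move=> /(canRL (addrK _)).
  rewrite scalerN => /(congr1 -%R); rewrite opprK => ->.
  rewrite scalerBr scalemxAr /cR scalerA divff // scale1r mulmxBr.
  have -> : (const_mx 1 : 'cV[R]_d.+2) *m (const_mx 1 : 'rV[R]_d.+2) = const_mx 1.
    by apply/matrixP => i j; rewrite !mxE big_ord1 !mxE mulr1.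
  rewrite !opprB addrCA; congr (_ + _).
  by apply/matrixP => i j; rewrite !mxE invfM mulrnAr mulVKf.
have cE i : cR 0 i = (c 0 i)%:~R.
  have /matrixP/(_ (lift i ord0) i) := Vg; rewrite [LHS]mxE => VgE.
  rewrite [c 0 i]mxE mulrNz VgE !mxE eq_sym (negbTE (neq_lift _ _)) mulr0n sub0r opprK.
  by rewrite big_ord1 !mxE mul1r.
have VN : mxR R (homog V *m N) = diag_mx (map_mx GRing.inv (r%:R *: l)).
  rewrite mul_row_col mxRD Vg mxR_mul mxR_const1 addrC (_ : mxR R c = cR) ?subrK //.
  by apply/rowP => i; rewrite cE mxE.
have mE i : (m 0 i)%:~R = (r%:R * l 0 i)^-1 :> R.
  have /matrixP/(_ i i) := VN; rewrite [LHS]mxE [RHS]mxE eqxx mulr1n [RHS]mxE [in RHS]mxE => <-.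
  congr (_%:~R); rewrite mul_row_col [RHS]mxE addrC [LHS]mxE; congr (_ + _).
  by rewrite [RHS]mxE big_ord1 [const_mx 1 _ _]mxE mul1r.
have VNz : homog V *m N = diag_mx m.
  apply: (@mxR_inj R); rewrite VN mxR_diag; congr diag_mx.
  by apply/rowP => i; rewrite mxE [in LHS]mxE [RHS]mxE mE.
exists r, (- (w *m invmx U)), N, m; split => //; split => //.
  by move=> i; rewrite -(ltr0z R) mE invr_gt0 mulr_gt0 ?ltr0n.
have /mul_homogE[/(_ 0) sl lW0] := lW.
apply: (@mxR_inj R); rewrite mxR_mul.
have -> : mxR R (row_mx r%:Z%:M (- (w *m invmx U))) = (r%:R *: l) *m mxR R (homog V).
  rewrite mxR_row_mx mxR_natM mxR_homog /homog mul_mx_row; congr row_mx.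
    apply/matrixP => i j; rewrite !ord1 !mxE mulr1n -[LHS]mulr1 -[X in _ * X = _]sl mulr_sumr.
    by apply: eq_bigr => k _; rewrite !mxE mulr1.
  have UR : mxR R U *m mxR R (invmx U) = 1%:M by rewrite -mxR_mul mulmxV // /mxR map_mx1.
  rewrite -[RHS]mulmx1 -UR mulmxA.
  have : (r%:R *: l) *m mxR R V *m mxR R U = - mxR R w.
    apply/eqP; rewrite -addr_eq0 -[X in _ == X]lW0 mxR_affine mulmxDr mxR_natZ.
    rewrite mulmxA -!scalemxAl -scalemxAr -!scalemxAl mulmxA.
    apply/eqP; congr (_ + _).
    rewrite (_ : l *m const_mx 1 = const_mx 1) ?const_mx1_mul //.
    by apply/matrixP => i j; rewrite !ord1 !mxE -[RHS]sl; apply: eq_bigr => k _; rewrite mxE mulr1.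
  by move=> ->; rewrite mulNmx -mxR_mul /mxR map_mxN.
rewrite -mulmxA -mxR_mul VN mxR_const1 mul_mx_diag; apply/rowP => i.
by rewrite !mxE divff // mulf_neq0 // gt_eqF.
Qed.

End Gorenstein.

(** * Facet heights of simplices that are not pyramids *)

Section Weights.
Variable R : realType.

(** The rows of [homog V] may generate a proper sublattice of full rank,
so the cancellation is done over [R]. *)
Lemma homog_cancel d e (V : 'M[int]_(d.+1, d)) (A B : 'M[int]_(1 + d, e)) :
  row_free (homog (mxR R V)) -> homog V *m A = homog V *m B -> A = B.
Proof.
rewrite homog_unit => uV /(congr1 (@mxR R _ _)); rewrite !mxR_mul mxR_homog.
by move=> /(congr1 (mulmx (invmx (homog (mxR R V) : 'M[R]_(1 + d))))); rewrite !mulKmx // => /mxR_inj.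
Qed.

(** An integral functional that is one at vertex [i] and zero at the other
vertices divides the [i]-th facet functional [col i N], with quotient [m i].  But
that one is primitive, as it takes the value one at the Gorenstein point. *)
Lemma lattice_pyramid_weight1 d r (V : 'M[int]_(d.+2, d.+1)) z N m :
  gorenstein_normals V r z N m ->
  lattice_pyramid (hull (mxR R V)) <-> exists i, m 0 i = 1.
Proof.
move=> H; have fV := normals_free R H; have [m0 VN zN] := H.
have VNi i : homog V *m col i N = m 0 i *: delta_mx i 0.
  rewrite [col i N]colE mulmxA -colE VN; apply/colP => j; rewrite !mxE eqxx andbT mulr_natr.
  by have [->|_] := eqVneq j i; rewrite ?mulr1n ?mulr0n.
split=> [/(lattice_pyramid_facet fV)[i [f Vf]]|[i mi]]; last first.
  by apply: (facet_lattice_pyramid (f := col i N) fV); rewrite VNi mi scale1r.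
exists i.
have NE : col i N = m 0 i *: f by apply: (homog_cancel fV); rewrite VNi -scalemxAr Vf.
have /matrixP/(_ 0 0) : row_mx r%:Z%:M z *m col i N = 1%:M.
  by rewrite [col i N]colE mulmxA -colE zN; apply/matrixP => a b; rewrite !ord1 !mxE.
rewrite NE -scalemxAr mxE [RHS]mxE eqxx mulr1n => mz.
have : m 0 i \is a GRing.unit.
  by apply/unitrP; eexists; rewrite mulrC; split; exact: mz.
rewrite -[_ \is a _]/((m 0 i == 1) || (m 0 i == -1)) => /orP[/eqP //|/eqP mi].
by have := m0 i; rewrite mi.
Qed.

(** Each [m i] is at least two, so each of the [d + 2 = 2 r] numbers
[1 / m i] is at most one half, whereas they add up to [r]. *)
Lemma normals_weights2 d r (V : 'M[int]_(d.+2, d.+1)) z N m :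
  gorenstein_normals V r z N m -> ~ lattice_pyramid (hull (mxR R V)) ->
  r.*2 = d.+2 -> m = const_mx 2.
Proof.
move=> H npyr rd; have [m0 _ _] := H.
have m2 i : 2 <= m 0 i.
  have mi0 := m0 i; have mi1 : m 0 i <> 1.
    by move=> mi; apply: npyr; apply/(lattice_pyramid_weight1 H); exists i.
  by rewrite -[2]/(1 + 1) lezD1 lt_neqAle -gtz0_ge1 mi0 andbT eq_sym; apply/eqP.
have gap i : 0 <= 2^-1 - (m 0 i)%:~R^-1 :> R.
  have mR : 2%:R <= (m 0 i)%:~R :> R by have := m2 i; rewrite -(ler_int R).
  by rewrite subr_ge0 lef_pV2 ?posrE ?(lt_le_trans _ mR) // ltr0n.
have : \sum_i (2^-1 - (m 0 i)%:~R^-1) = 0 :> R.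
  rewrite sumrB (sum_inv_weights R H) sumr_const card_ord -rd -muln2.
  by rewrite -[_^-1 *+ _]mulr_natr natrM mulrCA mulVf ?pnatr_eq0 // mulr1 subrr.
move=> /eqP; rewrite psumr_eq0 // => /allP eq0.
apply/rowP => i; rewrite mxE; apply: (@intr_inj R).
have /eqP := eq0 i (mem_index_enum i); move/eqP; rewrite subr_eq0 => /eqP /invr_inj <-.
by [].
Qed.

End Weights.

(** * Simplices with all facet heights two, modulo two *)

Definition mod2 m n (A : 'M[int]_(m, n)) : 'M['F_2]_(m, n) := map_mx intr A.

Lemma mod2_eq0 m n (A : 'M[int]_(m, n)) : mod2 A = 0 <-> exists B, A = 2 *: B.
Proof.
have F2 := @pchar_Fp 2 isT.
split=> [/matrixP A0|[B ->]]; last first.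
  by apply/matrixP => i j; rewrite !mxE; apply/eqP; rewrite -(dvdz_pcharf F2) dvdz_mulr.
exists (\matrix_(i, j) (A i j %/ 2)%Z); apply/matrixP => i j.
have /eqP := A0 i j; rewrite !mxE -(dvdz_pcharf F2) => /divzK {1}<-.
by rewrite mulrC.
Qed.

Lemma mod2_mul m n p (A : 'M[int]_(m, n)) (B : 'M[int]_(n, p)) :
  mod2 (A *m B) = mod2 A *m mod2 B.
Proof. exact: map_mxM. Qed.

Lemma mod2_homog m d (V : 'M[int]_(m, d)) : mod2 (homog V) = homog (mod2 V).
Proof. exact: map_homog. Qed.

Lemma F2_addrr n (x : 'rV['F_2]_n) : x + x = 0.
Proof. by apply/rowP => j; rewrite !mxE (addrr_pchar2 (@pchar_Fp 2 isT)). Qed.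

Lemma F2_mulmx_sum m n (c : 'rV['F_2]_m) (A : 'M['F_2]_(m, n)) :
  c *m A = \sum_(i in [set i | c 0 i == 1]%SET) row i A.
Proof.
rewrite mulmx_sum_row [RHS]big_mkcond; apply: eq_bigr => i _; rewrite inE.
have [-> | ] := eqVneq (c 0 i) 1; first by rewrite scale1r.
by case: (c 0 i) => [[|[|//]] lt2] // _; rewrite (_ : Ordinal lt2 = 0) ?scale0r //; exact: val_inj.
Qed.

(** The sets [A] with [\sum_(i in A) X i = 0] form an even code which
contains the full set, hence is closed under complement.  Up to complement, its
members are empty or pairs, and [X i + X j = 0] means [X i = X j]. *)
Lemma zero_sums_of_pairs n (X Y : 'I_6 -> 'rV['F_2]_n) :
  \sum_i X i = 0 -> \sum_i Y i = 0 ->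
  (forall A : {set 'I_6}, \sum_(i in A) X i = 0 -> ~~ odd #|A|) ->
  (forall i j, X i = X j -> Y i = Y j) ->
  forall A : {set 'I_6}, \sum_(i in A) X i = 0 -> \sum_(i in A) Y i = 0.
Proof.
move=> X0 Y0 evenX XY.
have sumC (Z : 'I_6 -> 'rV['F_2]_n) (A : {set 'I_6}) : \sum_i Z i = 0 ->
    \sum_(i in A) Z i = 0 -> \sum_(i in ~: A) Z i = 0.
  rewrite (bigID (fun i => i \in A)) /= => + ZA; rewrite ZA add0r => ZC; rewrite -[RHS]ZC.
  by apply: eq_bigl => i; rewrite inE.
have small (A : {set 'I_6}) : (#|A| <= 3)%N -> \sum_(i in A) X i = 0 -> \sum_(i in A) Y i = 0.
  move=> A3 AX; have := evenX _ AX.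
  have : (#|A| \in [:: 0; 1; 2; 3])%N by move: A3; case: #|A| => [|[|[|[|]]]].
  rewrite !inE => /or4P[/eqP|/eqP->|/eqP A2|/eqP->] //.
    by move=> /cards0_eq->; rewrite big_set0.
  move=> _; have /cards2P[i [j [ij AE]]] : #|A| == 2 by apply/eqP.
  move: AX; rewrite AE !big_setU1 ?inE //= !big_set1 => XX.
  have /XY -> : X i = X j by rewrite -[LHS]addr0 -(F2_addrr (X j)) addrA XX add0r.
  exact: F2_addrr.
move=> A AX; have [A3|A3] := leqP #|A| 3; first exact: small.
rewrite -[A]finset.setCK; apply: (sumC) => //; apply: small; last exact: sumC.
by have := cardsC A; rewrite card_ord => cA; rewrite -(leq_add2l #|A|) cA (leq_add A3).
Qed.

Section Half.
Variable R : realType.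

(** The lattice simplices of dimension five with a Gorenstein point of
index three and with all vertices at height two over the opposite facet. *)
Definition half_simplex (V : 'M[int]_(6, 5)) : Prop :=
  exists z N, gorenstein_normals V 3 z N (const_mx 2).

Lemma half_simplex_free V : half_simplex V -> row_free (homog (mxR R V)).
Proof. by move=> [z [N /normals_free]]. Qed.

Lemma half_simplex_inverse V : half_simplex V ->
  exists2 N : 'M[int]_6, homog V *m N = 2%:M & (N *m homog V = 2%:M /\ mod2 ((const_mx 1 : 'rV[int]_6) *m homog V) = 0).
Proof.
move=> hV; have fV := half_simplex_free hV; have [z [N [_ + zN]]] := hV.
rewrite diag_const_mx => VN; exists N => //.
have NV : N *m homog V = 2%:M.
  apply: (homog_cancel fV).
  by rewrite mulmxA VN mul_scalar_mx mul_mx_scalar.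
split=> //; rewrite -zN -mulmxA; apply/mod2_eq0; exists (row_mx 3%:Z%:M z).
by rewrite [N *m _]NV mul_mx_scalar.
Qed.

Lemma half_simplex_sum V : half_simplex V -> \sum_i row i (mod2 V) = 0.
Proof.
move=> /half_simplex_inverse[N _ [_]].
rewrite mod2_mul mod2_homog /homog mul_mx_row -[0]row_mx0 => /eq_row_mx[_].
rewrite mulmx_sum_row => s0; rewrite -[RHS]s0.
by apply: eq_bigr => i _; rewrite !mxE scale1r.
Qed.

Definition same_parity (V W : 'M[int]_(6, 5)) := forall i j,
  (row i (mod2 V) == row j (mod2 V)) = (row i (mod2 W) == row j (mod2 W)).

(** The candidate is half of [N *m homog W], where [N] is twice the inverse
of [homog V].  It is integral because the rows of [N], modulo two, are relations
between the rows of [homog V], and these are also relations between the rows of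
[homog W]. *)
Lemma half_simplex_transition V W : half_simplex V -> half_simplex W -> same_parity V W ->
  exists B : 'M[int]_(1 + 5), homog W = homog V *m B.
Proof.
move=> hV hW VW; have fV := half_simplex_free hV.
have [N VN [NV V1]] := half_simplex_inverse hV.
have [_ _ [_ W1]] := half_simplex_inverse hW.
suff /mod2_eq0[B NW] : mod2 (N *m homog W) = 0.
  exists B; have : 2 *: homog W = 2 *: (homog V *m B).
    by rewrite scalemxAr -NW mulmxA VN mul_scalar_mx.
  by move=> /matrixP WB; apply/matrixP => i j; have := WB i j; rewrite !mxE => /mulfI; apply.
have V0 : mod2 N *m mod2 (homog V) = 0.
  by rewrite -mod2_mul NV; apply/mod2_eq0; exists 1%:M; rewrite scalemx1.
have total (U : 'M[int]_(6, 5)) : mod2 ((const_mx 1 : 'rV[int]_6) *m homog U) = 0 ->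
    \sum_i row i (mod2 (homog U)) = 0.
  rewrite mod2_mul mulmx_sum_row => s0; rewrite -[RHS]s0.
  by apply: eq_bigr => i _; rewrite !mxE scale1r.
rewrite mod2_mul; apply/row_matrixP => i; rewrite row_mul row0 F2_mulmx_sum.
apply: zero_sums_of_pairs (total _ V1) (total _ W1) _ _ _ _ => [A||].
- move=> /rowP/(_ (lshift 5 (0 : 'I_1))); rewrite summxE [RHS]mxE.
  under eq_bigr do rewrite mod2_homog row_homog /homog row_mxEl mxE.
  rewrite sumr_const => /eqP; rewrite -(dvdn_pcharf (@pchar_Fp 2 isT)).
  by rewrite dvdn2.
- move=> a b; rewrite mod2_homog !row_homog => /homog_inj /eqP.
  by rewrite VW => /eqP ab; rewrite mod2_homog !row_homog ab.
- by rewrite -F2_mulmx_sum -row_mul V0 row0.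
Qed.

(** The transition matrices in both directions are inverse to each other.
They fix the column of ones, hence come from an integral affine transformation
of the space. *)
Lemma half_simplex_parity V W : half_simplex V -> half_simplex W -> same_parity V W ->
  unimod_equiv (hull (mxR R V)) (hull (mxR R W)).
Proof.
move=> hV hW VW; have [B WB] := half_simplex_transition hV hW VW.
have WV : same_parity W V by move=> i j; rewrite VW.
have [C VC] := half_simplex_transition hW hV WV.
have fV := half_simplex_free hV.
have BC : B *m C = 1%:M by apply: (homog_cancel fV); rewrite mulmxA -WB -VC mulmx1.
have B1 : lsubmx B = col_mx 1%:M 0.
  apply: (homog_cancel fV).
  have : lsubmx (homog V *m B) = const_mx 1 by rewrite -WB row_mxKl.
  rewrite -{1}(hsubmxK B) mul_mx_row row_mxKl => ->.
  by rewrite mul_row_col mulmx0 addr0 mulmx1.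
have [w [U BE]] : exists w U, B = block_mx 1%:M w 0 U.
  exists (usubmx (rsubmx B)), (dsubmx (rsubmx B)).
  by rewrite block_mxEh -B1 vsubmxK hsubmxK.
have Uu : U \in unitmx.
  have [Bu _] := mulmx1_unit BC; move: Bu.
  by rewrite !unitmxE BE det_ublock det1 mul1r.
have -> : W = V *m U + const_mx 1 *m w by apply: homog_inj; rewrite homog_affine -BE.
exact: unimod_equiv_hull.
Qed.

Lemma hull_row_perm m d (s : {perm 'I_m}) (V : 'M[R]_(m, d)) : hull (row_perm s V) = hull V.
Proof.
have row_permE i : row i (row_perm s V) = row (s i) V by apply/rowP => j; rewrite !mxE.
apply/seteqP; split; apply: hull_sub; try exact: convex_hull; move=> i.
  by rewrite row_permE; exact: hull_row.
by rewrite -[i](permKV s) -row_permE; exact: hull_row.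
Qed.

Lemma half_simplex_row_perm (s : {perm 'I_6}) V : half_simplex V -> half_simplex (row_perm s V).
Proof.
move=> [z [N [m0 VN zN]]]; exists z, (col_perm s N); split => //.
  apply/matrixP => i j; have /matrixP/(_ (s i) (s j)) := VN; rewrite !mxE (inj_eq perm_inj) => <-.
  apply: eq_bigr => k _; rewrite [X in _ * X]mxE; congr (_ * _).
  by rewrite !mxE; case: fintype.split => ?; rewrite !mxE.
apply/matrixP => i j; have /matrixP/(_ i (s j)) := zN; rewrite !mxE => <-.
by apply: eq_bigr => k _; rewrite [X in _ * X]mxE.
Qed.

(** Translations do not change differences, and a unimodular matrix remains
invertible modulo two. *)
Lemma parity_affine (V : 'M[int]_(6, 5)) (U : 'M[int]_5) (w : 'rV[int]_5) :
  U \in unitmx -> same_parity V (V *m U + const_mx 1 *m w).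
Proof.
move=> Uu i j; have rowE k : row k (mod2 (V *m U + const_mx 1 *m w)) = row k (mod2 V) *m mod2 U + mod2 w.
  rewrite /mod2 map_mxD !map_mxM linearD /= !row_mul; congr (_ + _).
  by apply/rowP => l; rewrite !mxE big_ord1 !mxE rmorph1 mul1r.
rewrite !rowE (inj_eq (addIr _)); apply/idP/idP => /eqP; first by move->.
move=> /(congr1 (mulmx^~ (mod2 (invmx U)))); rewrite -!mulmxA -!mod2_mul mulmxV //.
by rewrite /mod2 map_mx1 !mulmx1 => ->.
Qed.

End Half.

(** * Partitions of six vertices *)

(** A partition of the first [n] numbers is encoded by labelling each number
with the least element of its class, so the [i]-th label is at most [i]. *)
Fixpoint label_seqs n : seq (seq nat) :=
  if n is n'.+1 then [seq rcons L a | L <- label_seqs n', a <- iota 0 n] else [:: [::]].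

Lemma mem_label_seqs n (L : seq nat) :
  size L = n -> (forall i, (i < n)%N -> (nth 0%N L i <= i)%N) -> L \in label_seqs n.
Proof.
elim: n L => [|n IH] L; first by move/size0nil->.
case/lastP: L => [//|L a]; rewrite size_rcons => -[sL] Lle.
apply/allpairsP; exists (L, a); split => //; rewrite -?[_ \in iota _ _]/(a \in iota 0 n.+1) ?[(L, a).1]/=.
  apply: IH => // i ltin; have := Lle i (ltnW ltin).
  by rewrite nth_rcons sL ltin.
by have := Lle n (ltnSn n); rewrite nth_rcons sL ltnn eqxx mem_iota.
Qed.

(** The ways of ordering six numbers into three increasing pairs. *)
Definition matchings : seq (seq nat) :=
  [seq p <- permutations (iota 0 6) |
    [&& nth 0 p 0 < nth 0 p 1, nth 0 p 2 < nth 0 p 3 & nth 0 p 4 < nth 0 p 5]%N].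

(** The condition that two disjoint pairs inside classes leave a pair inside
a class.  Nested conditionals avoid evaluating the later tests. *)
Definition pairing_closed (L : seq nat) : bool :=
  all (fun p => let l i := nth 0%N L (nth 0%N p i) in
    if l 0%N == l 1%N then if l 2%N == l 3%N then l 4%N == l 5%N else true else true) matchings.

(** The label sequences of the six types of partitions that satisfy
[pairing_closed], with the classes sorted by decreasing size. *)
Definition parity_types : seq (seq nat) :=
  [:: [:: 0; 0; 0; 0; 0; 0]; [:: 0; 0; 0; 0; 4; 4]; [:: 0; 0; 0; 3; 4; 5];
      [:: 0; 0; 2; 2; 4; 4]; [:: 0; 0; 2; 3; 4; 5]; [:: 0; 1; 2; 3; 4; 5]]%N.

Definition parity_type k : seq nat := nth [::] parity_types k.

(** Listing the numbers by decreasing class size, and class by class among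
classes of equal size, brings a partition into a form that depends only on its
class sizes. *)
Definition by_class_size (L : seq nat) : seq nat :=
  sort (fun i j => let a := nth 0%N L i in let b := nth 0%N L j in
    let ca := count_mem a L in let cb := count_mem b L in
    (cb < ca)%N || (ca == cb) && (a <= b)%N) (iota 0 6).

Definition same_pattern (L : seq nat) (p : seq nat) (T : seq nat) : bool :=
  all (fun i => all (fun j =>
    (nth 0%N L (nth 0%N p i) == nth 0%N L (nth 0%N p j)) == (nth 0%N T i == nth 0%N T j))
  (iota 0 6)) (iota 0 6).

(** An exhaustive search over the 720 label sequences.  The five shapes
excluded are 2+2+1+1, 3+2+1, 3+3, 4+1+1 and 5+1: in each of them, two disjoint
pairs inside classes can be chosen so that the two remaining elements lie in
different classes. *)
Lemma pairing_closed_types :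
  all (fun L => if pairing_closed L then has (same_pattern L (by_class_size L)) parity_types else true)
    (label_seqs 6).
Proof. by vm_compute. Qed.

(** The relation is turned into a sequence of labels, to which
[pairing_closed_types] applies. *)
Lemma pairing_relation_type (e : rel 'I_6) :
  reflexive e -> symmetric e -> transitive e ->
  (forall i j k l a b, uniq [:: i; j; k; l; a; b] -> e i j -> e k l -> e a b) ->
  exists k, (k < 6)%N /\ exists s : {perm 'I_6}, forall i j : 'I_6,
    e (s i) (s j) = (nth 0%N (parity_type k) i == nth 0%N (parity_type k) j).
Proof.
move=> er es et e3.
pose f i := find (e i) (enum 'I_6).
have fE i j : (f i == f j) = e i j.
  apply/eqP/idP => [fij|eij]; last first.
    apply: eq_find => k; apply/idP/idP; last exact: et.
    by apply: et; rewrite es.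
  have hase k : has (e k) (enum 'I_6) by apply/hasP; exists k; rewrite ?mem_enum.
  have := nth_find i (hase i); rewrite -/(f i) fij => eix.
  by apply: et eix _; rewrite es; exact: nth_find.
have fle i : (f i <= i)%N.
  by rewrite leqNgt; apply/negP => /(before_find i); rewrite nth_ord_enum er.
pose L := [seq f i | i <- enum 'I_6].
have sL : size L = 6 by rewrite size_map size_enum_ord.
have Lf (i : 'I_6) : nth 0%N L i = f i.
  by rewrite (nth_map i) ?size_enum_ord // nth_ord_enum.
have LP : L \in label_seqs 6.
  by apply: mem_label_seqs => // i i6; rewrite (Lf (Ordinal i6)); exact: fle.
have Lclosed : pairing_closed L.
  apply/allP => p; rewrite mem_filter mem_permutations => /andP[_ pP] /=.
  have sp : size p = 6 by rewrite (perm_size pP) size_iota.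
  have plt i : (i < 6)%N -> (nth 0 p i < 6)%N.
    move=> i6; have : nth 0%N p i \in iota 0 6 by rewrite -(perm_mem pP) mem_nth ?sp.
    by rewrite mem_iota.
  pose o i (i6 : (i < 6)%N) : 'I_6 := Ordinal (plt i i6).
  have LE i i6 : nth 0%N L (nth 0%N p i) = f (@o i i6) by rewrite -Lf.
  rewrite (LE 0%N isT) (LE 1%N isT) (LE 2 isT) (LE 3 isT) (LE 4 isT) (LE 5 isT) !fE.
  case: ifP => // e01; case: ifP => // e23; apply: e3 e01 e23.
  rewrite -(map_inj_uniq val_inj).
  set q := map _ _; have -> : q = [:: nth 0 p 0; nth 0 p 1; nth 0 p 2; nth 0 p 3; nth 0 p 4; nth 0 p 5]%N by [].
  have <- : p = [:: nth 0 p 0; nth 0 p 1; nth 0 p 2; nth 0 p 3; nth 0 p 4; nth 0 p 5]%N.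
    by case: p sp {pP plt o LE q} => [|? [|? [|? [|? [|? [|? [|? ?]]]]]]].
  by rewrite (perm_uniq pP) iota_uniq.
have /allP/(_ L LP) := pairing_closed_types; rewrite Lclosed.
move=> /(has_nthP [::])[k k6 /allP pat]; exists k; split => //.
set p := by_class_size L in pat.
have pP : perm_eq p (iota 0 6) by rewrite perm_sort.
have sp : size p = 6 by rewrite (perm_size pP) size_iota.
have plt (i : 'I_6) : (nth 0 p i < 6)%N.
  have : nth 0%N p i \in iota 0 6 by rewrite -(perm_mem pP) mem_nth ?sp.
  by rewrite mem_iota.
pose g (i : 'I_6) := Ordinal (plt i).
have g_inj : injective g.
  move=> i j /(congr1 val) /= /eqP; rewrite nth_uniq ?sp // ?(perm_uniq pP) ?iota_uniq //.
  by move=> /eqP /val_inj.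
exists (perm g_inj) => i j; rewrite !permE -fE -!Lf /=.
have ltI (x : 'I_6) : (x : nat) \in iota 0 6 by rewrite mem_iota /=.
by have /allP/(_ _ (ltI j))/eqP := pat _ (ltI i).
Qed.

(** * The six simplices *)

(** The right-hand side evaluates on closed terms, so that identities
between explicit sums can be decided by computation. *)
Lemma sum_ord_foldr (A : nmodType) n (F : nat -> A) :
  \sum_(i < n) F i = foldr (fun i s => F i + s) 0 (iota 0 n).
Proof.
rewrite -(big_mkord xpredT) /index_iota subn0.
by elim: (iota 0 n) => [|i s IH]; rewrite ?big_nil // big_cons IH.
Qed.

Definition fun_mx m n (f : nat -> nat -> int) : 'M[int]_(m, n) := \matrix_(i, j) f i j.

Lemma fun_mx_mul m n p (f g h : nat -> nat -> int) :
  all (fun i => all (fun j =>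
    foldr (fun k s => f i k * g k j + s) 0 (iota 0 n) == h i j) (iota 0 p)) (iota 0 m) ->
  fun_mx m n f *m fun_mx n p g = fun_mx m p h.
Proof.
move=> /allP fgh; apply/matrixP => i j.
have /fgh/allP/(_ j) : (i : nat) \in iota 0 m by rewrite mem_iota /=.
rewrite mem_iota /= ltn_ord => /(_ isT)/eqP; rewrite !mxE => <-.
by rewrite -sum_ord_foldr; apply: eq_bigr => k _; rewrite !mxE.
Qed.

Lemma row_mx_fun m d (a : 'cV[int]_m) (c : nat -> int) (f : nat -> nat -> int) :
  (forall i, a i 0 = c i) ->
  row_mx a (fun_mx m d f) = fun_mx m (1 + d) (fun i j => if j is j'.+1 then f i j' else c i).
Proof.
move=> ac; apply/matrixP => i j; rewrite !mxE; case: splitP => k ->; last by rewrite mxE.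
by rewrite ord1 ac.
Qed.

Definition entry (s : seq (seq int)) (i j : nat) : int := nth 0 (nth [::] s i) j.

(** Representatives, by their vertices.  Modulo two the vertices are equal
exactly where the labels in [parity_types] are; even vectors are added to make
them affinely independent, in such a way that all vertices add up to twice
the point [(1, 1, 1, 1, 1)]. *)
Definition parity_vertices : seq (seq (seq int)) :=
  [:: [:: [:: 0; 0; 0; 0; 0]; [:: 2; 0; 0; 0; 0]; [:: 0; 2; 0; 0; 0];
          [:: 0; 0; 2; 0; 0]; [:: 0; 0; 0; 2; 0]; [:: 0; 0; 0; 0; 2]];
      [:: [:: 0; 0; 0; 0; 0]; [:: 0; 2; 0; 0; 0]; [:: 0; 0; 2; 0; 0];
          [:: 0; 0; 0; 2; 0]; [:: 1; 0; 0; 0; 0]; [:: 1; 0; 0; 0; 2]];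
      [:: [:: 0; 0; 0; 0; 0]; [:: 0; 0; 0; 2; 0]; [:: 0; 0; 0; 0; 2];
          [:: 1; 0; 0; 0; 0]; [:: 0; 1; 0; 0; 0]; [:: 1; 1; 2; 0; 0]];
      [:: [:: 0; 0; 0; 0; 0]; [:: 0; 0; 2; 0; 0]; [:: 1; 0; 0; 0; 0];
          [:: 1; 0; 0; 2; 0]; [:: 0; 1; 0; 0; 0]; [:: 0; 1; 0; 0; 2]];
      [:: [:: 0; 0; 1; 0; 0]; [:: 0; 0; 1; 0; 2]; [:: 0; 0; 0; 0; 0];
          [:: 1; 0; 0; 0; 0]; [:: 0; 1; 0; 0; 0]; [:: 1; 1; 0; 2; 0]];
      [:: [:: 0; 0; 0; 0; 0]; [:: 1; 0; 0; 0; 0]; [:: 0; 1; 0; 0; 0];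
          [:: 0; 0; 1; 0; 0]; [:: 0; 0; 0; 1; 0]; [:: 1; 1; 1; 1; 2]]].

(** Twice the inverses of the matrices [homog V] for the [V] listed in
[parity_vertices]. *)
Definition parity_normals : seq (seq (seq int)) :=
  [:: [:: [:: 2; 0; 0; 0; 0; 0]; [:: -1; 1; 0; 0; 0; 0]; [:: -1; 0; 1; 0; 0; 0];
          [:: -1; 0; 0; 1; 0; 0]; [:: -1; 0; 0; 0; 1; 0]; [:: -1; 0; 0; 0; 0; 1]];
      [:: [:: 2; 0; 0; 0; 0; 0]; [:: -2; 0; 0; 0; 2; 0]; [:: -1; 1; 0; 0; 0; 0];
          [:: -1; 0; 1; 0; 0; 0]; [:: -1; 0; 0; 1; 0; 0]; [:: 0; 0; 0; 0; -1; 1]];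
      [:: [:: 2; 0; 0; 0; 0; 0]; [:: -2; 0; 0; 2; 0; 0]; [:: -2; 0; 0; 0; 2; 0];
          [:: 1; 0; 0; -1; -1; 1]; [:: -1; 1; 0; 0; 0; 0]; [:: -1; 0; 1; 0; 0; 0]];
      [:: [:: 2; 0; 0; 0; 0; 0]; [:: -2; 0; 2; 0; 0; 0]; [:: -2; 0; 0; 0; 2; 0];
          [:: -1; 1; 0; 0; 0; 0]; [:: 0; 0; -1; 1; 0; 0]; [:: 0; 0; 0; 0; -1; 1]];
      [:: [:: 0; 0; 2; 0; 0; 0]; [:: 0; 0; -2; 2; 0; 0]; [:: 0; 0; -2; 0; 2; 0];
          [:: 2; 0; -2; 0; 0; 0]; [:: 0; 0; 1; -1; -1; 1]; [:: -1; 1; 0; 0; 0; 0]];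
      [:: [:: 2; 0; 0; 0; 0; 0]; [:: -2; 2; 0; 0; 0; 0]; [:: -2; 0; 2; 0; 0; 0];
          [:: -2; 0; 0; 2; 0; 0]; [:: -2; 0; 0; 0; 2; 0]; [:: 3; -1; -1; -1; -1; 1]]].

Definition parity_simplex k : 'M[int]_(6, 5) := fun_mx 6 5 (entry (nth [::] parity_vertices k)).

Lemma parity_simplex_half k : (k < 6)%N -> half_simplex (parity_simplex k).
Proof.
move=> k6; exists (fun_mx 1 5 (fun _ _ => 1)), (fun_mx 6 6 (entry (nth [::] parity_normals k))).
split=> [i||]; first by rewrite mxE.
  rewrite /homog /parity_simplex (@row_mx_fun _ _ _ (fun=> 1)) => [|i]; last by rewrite mxE.
  have -> : diag_mx (const_mx 2) = fun_mx 6 6 (fun i j => if i == j then 2 else 0).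
    apply/matrixP => i j; rewrite !mxE -[_ == _ :> nat]/(i == j).
    by case: eqP => _; rewrite ?mulr1n ?mulr0n.
  apply: fun_mx_mul; move: k k6.
  by do 6 (case; first by move=> _; vm_compute).
rewrite (@row_mx_fun _ _ _ (fun=> 3)) => [|i]; last by rewrite ord1 mxE eqxx.
have -> : const_mx 1 = fun_mx 1 6 (fun _ _ => 1) by apply/matrixP => i j; rewrite !mxE.
apply: fun_mx_mul; move: k k6.
by do 6 (case; first by move=> _; vm_compute).
Qed.

(** Equality of rows modulo two is reduced to a finite test on the
entries. *)
Lemma parity_simplex_type k : (k < 6)%N -> forall i j : 'I_6,
  (row i (mod2 (parity_simplex k)) == row j (mod2 (parity_simplex k))) =
  (nth 0%N (parity_type k) i == nth 0%N (parity_type k) j).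
Proof.
move=> k6 i j; pose e := entry (nth [::] parity_vertices k).
have -> : (row i (mod2 (parity_simplex k)) == row j (mod2 (parity_simplex k))) =
    all (fun l => (e i l)%:~R == (e j l)%:~R :> 'F_2) (iota 0 5).
  apply/eqP/allP => [/rowP ij l|ij].
    by rewrite mem_iota => l5; have := ij (Ordinal l5); rewrite !mxE => /eqP.
  by apply/rowP => l; rewrite !mxE; apply/eqP/ij; rewrite mem_iota /=.
suff /allP check : all (fun a => all (fun b =>
    all (fun l => (e a l)%:~R == (e b l)%:~R :> 'F_2) (iota 0 5) ==
    (nth 0%N (parity_type k) a == nth 0%N (parity_type k) b)) (iota 0 6)) (iota 0 6).
  have ltI (x : 'I_6) : (x : nat) \in iota 0 6 by rewrite mem_iota /=.
  by have /allP/(_ _ (ltI j))/eqP := check _ (ltI i).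
rewrite {}/e; move: k k6 {i j}.
by do 6 (case; first by move=> _; vm_compute).
Qed.

(** The sum of the cubes of the sizes of the congruence classes of vertices
modulo two: the class of a vertex contributes its size squared, once for each of
its elements.  The sums of squares would not do, since they agree for the types
3+1+1+1 and 2+2+2. *)
Definition parity_cubes (V : 'M[int]_(6, 5)) : nat :=
  (\sum_(i < 6) (\sum_(j < 6) (row i (mod2 V) == row j (mod2 V))) ^ 2)%N.

Lemma parity_cubes_row_perm (s : {perm 'I_6}) V : parity_cubes (row_perm s V) = parity_cubes V.
Proof.
have rowE i : row i (mod2 (row_perm s V)) = row (s i) (mod2 V) by apply/rowP => l; rewrite !mxE.
rewrite /parity_cubes [RHS](reindex_inj (@perm_inj _ s)); apply: eq_bigr => i _.
rewrite [in RHS](reindex_inj (@perm_inj _ s)); congr (_ ^ 2)%N.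
by apply: eq_bigr => j _; rewrite !rowE.
Qed.

Lemma parity_cubes_simplex k : (k < 6)%N ->
  parity_cubes (parity_simplex k) = nth 0%N [:: 216; 72; 30; 24; 12; 6]%N k.
Proof.
move=> k6; pose T := parity_type k.
have -> : parity_cubes (parity_simplex k) =
    foldr (fun i s => (foldr (fun j t => (nth 0 T i == nth 0 T j) + t) 0 (iota 0 6)) ^ 2 + s)%N 0%N (iota 0 6).
  rewrite -(@sum_ord_foldr nat) /parity_cubes; apply: eq_bigr => i _.
  rewrite -(@sum_ord_foldr nat); congr (_ ^ 2)%N.
  by apply: eq_bigr => j _; rewrite parity_simplex_type.
rewrite {}/T; move: k k6.
by do 6 (case; first by move=> _; vm_compute).
Qed.

Section Classification.
Variable R : realType.

(** Congruence modulo two satisfies the hypothesis of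
[pairing_relation_type] because the six vertices add up to zero modulo two. *)
Lemma half_simplex_parity_type V : half_simplex V ->
  exists2 k, (k < 6)%N & unimod_equiv (hull (mxR R V)) (hull (mxR R (parity_simplex k))).
Proof.
move=> hV; pose e : rel 'I_6 := fun i j => row i (mod2 V) == row j (mod2 V).
have [||||k [k6 [s sE]]] := @pairing_relation_type e.
- by move=> i; exact: eqxx.
- by move=> i j; exact: eq_sym.
- by move=> j i k /eqP ij /eqP jk; rewrite /e ij jk.
- move=> i j k l a b un /eqP ij /eqP kl.
  have pe : perm_eq (index_enum 'I_6) [:: i; j; k; l; a; b].
    rewrite perm_sym uniq_perm ?index_enum_uniq //.
    have [x _||_ eqi] := @uniq_min_size _ [:: i; j; k; l; a; b] (index_enum 'I_6) un.
      exact: mem_index_enum.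
      by rewrite -sum1_size sum1_card card_ord.
    exact: eqi.
  have := half_simplex_sum R hV; rewrite (perm_big _ pe) !big_cons big_nil /= addr0.
  rewrite ij kl addrA F2_addrr add0r addrA F2_addrr add0r => ab.
  by apply/eqP; rewrite -[LHS]addr0 -(F2_addrr (row b (mod2 V))) addrA ab add0r.
exists k => //; rewrite -(hull_row_perm s).
have -> : row_perm s (mxR R V) = mxR R (row_perm s V) by apply/matrixP => i j; rewrite !mxE.
apply: half_simplex_parity; [exact: half_simplex_row_perm | exact: parity_simplex_half |].
move=> i j; rewrite parity_simplex_type // -sE.
by congr (_ == _); apply/rowP => l; rewrite !mxE.
Qed.

Lemma half_simplex_invariant k l : (k < 6)%N -> (l < 6)%N ->
  unimod_equiv (hull (mxR R (parity_simplex k))) (hull (mxR R (parity_simplex l))) -> k = l.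
Proof.
move=> k6 l6 /unimod_equiv_hullP[U [w [Uu]]]; set W := _ + _ => kl.
have fk := half_simplex_free R (parity_simplex_half k6).
have fl := half_simplex_free R (parity_simplex_half l6).
have fW : row_free (homog (mxR R W)) by rewrite row_free_affine.
have [s WE] := hull_eq_perm fl fW kl.
have {}WE : W = row_perm s (parity_simplex l).
  by apply: (@mxR_inj R); rewrite WE; apply/matrixP => i j; rewrite !mxE.
have : parity_cubes W = parity_cubes (parity_simplex k).
  rewrite /parity_cubes; apply: eq_bigr => i _; congr (_ ^ 2)%N; apply: eq_bigr => j _.
  by rewrite -(parity_affine (parity_simplex k) w Uu).
rewrite WE parity_cubes_row_perm !parity_cubes_simplex // => /eqP.
by rewrite nth_uniq // => /eqP.
Qed.

(** The polytopes to be counted are the half simplices: degree three means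
codegree three, which is the Gorenstein index, and then no pyramid is left only
if all heights are two. *)
Lemma half_simplexP (P : set 'rV[R]_5) :
  [/\ lattice_polytope P, simplex P, has_dim P 5 &
      [/\ gorenstein P, degree P = 3%N & ~ lattice_pyramid P]] <->
  exists2 V, half_simplex V & P = hull (mxR R V).
Proof.
split=> [[latP simP dimP [gorP degP npyr]]|[V hV ->]].
  have [V fV PE] := (lattice_simplexP P).1 (And3 latP simP dimP).
  rewrite PE in gorP degP npyr *; exists V => //.
  have [r [z [N [m [r0 H]]]]] := gorenstein_normalsP fV gorP.
  have r3 : r = 3%N.
    by move: degP; rewrite /degree (normals_codegree R H r0); move: r r0 {H} => [|[|[|[|[|[|[|]]]]]]].
  move: H; rewrite r3 => H.
  by exists z, N; rewrite -(normals_weights2 H npyr erefl).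
have fV := half_simplex_free R hV; have [z [N H]] := hV.
have [latP simP dimP] : [/\ lattice_polytope (hull (mxR R V)), simplex (hull (mxR R V)) & has_dim (hull (mxR R V)) 5].
  by apply/lattice_simplexP; exists V.
split=> //; split; first exact: normals_gorenstein H.
  by rewrite /degree (normals_codegree R H).
by move=> /(lattice_pyramid_weight1 R H)[i]; rewrite mxE.
Qed.

End Classification.

Theorem theorem1p2 (R : realType) :
  ([set unimod_class P | P in
     [set P : set 'rV[R]_5 |
        [/\ lattice_polytope P, simplex P, has_dim P 5 &
            [/\ gorenstein P, degree P = 3%N & ~ lattice_pyramid P]]]]
   #= `I_6)%card.
Proof.
pose F k := unimod_class (hull (mxR R (parity_simplex k))).
have -> : [set unimod_class P | P in
     [set P : set 'rV[R]_5 |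
        [/\ lattice_polytope P, simplex P, has_dim P 5 &
            [/\ gorenstein P, degree P = 3%N & ~ lattice_pyramid P]]]] = F @` `I_6.
  apply/seteqP; split=> [_ [P /half_simplexP[V hV ->] <-]|_ [k /= k6 <-]].
    have [k k6 Vk] := half_simplex_parity_type R hV.
    by exists k => //; apply/unimod_class_eq/unimod_equiv_sym.
  exists (hull (mxR R (parity_simplex k))) => //; apply/half_simplexP.
  by exists (parity_simplex k) => //; exact: parity_simplex_half.
apply: inj_card_eq => k l /set_mem k6 /set_mem l6 /unimod_class_eq.
exact: half_simplex_invariant.
Qed.
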